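(* Let $\mathbb{K}$ be an infinite commutative field, $n$ a positive integer, and $V$ a linear subspace of $\operatorname{M}_n(\mathbb{K})$ with $\operatorname{codim} V<n-1$. Let $f : V \to \operatorname{M}_n(\mathbb{K})$ be an injective linear map such that $f\bigl(V \cap \operatorname{GL}_n(\mathbb{K})\bigr) \subset \operatorname{GL}_n(\mathbb{K})$. Then $f$ extends to a Frobenius automorphism of $\operatorname{M}_n(\mathbb{K})$.
   Context: $\operatorname{M}_n(\mathbb{K})$ is the space of $n\times n$ matrices over $\mathbb{K}$, $\operatorname{GL}_n(\mathbb{K})$ its set of invertible elements, and $\operatorname{codim} V$ denotes the codimension of $V$ in $\operatorname{M}_n(\mathbb{K})$. A Frobenius automorphism of $\operatorname{M}_n(\mathbb{K})$ is a map of the form $M\mapsto PMQ$ or of the form $M \mapsto PM^TQ$ for some $P,Q\in\operatorname{GL}_n(\mathbb{K})$. *)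

(* Defs.v *)
From mathcomp Require Import all_boot all_order all_algebra.

Set Implicit Arguments.
Unset Strict Implicit.
Unset Printing Implicit Defensive.

Local Open Scope ring_scope.

Definition codim (K : fieldType) (vT : vectType K) (V : {vspace vT}) : nat :=
  (\dim {:vT} - \dim V)%N.

(* "Automorphism" is meant linearly: such maps are in general not
   multiplicative. *)
Definition frobenius_automorphism (K : fieldType) (n : nat)
    (phi : 'M[K]_n -> 'M[K]_n) : Prop :=
  exists P Q : 'M[K]_n, [/\ P \in unitmx, Q \in unitmx &
    (forall M, phi M = P *m M *m Q) \/ (forall M, phi M = P *m M^T *m Q)].

(* Main.v *)
Require Import Defs.
From HB Require Import structures.
From mathcomp Require Import all_boot all_order all_algebra.
From mathcomp Require Import boolp classical_sets cardinality.
From mathcomp Require Import zify ring.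

Set Implicit Arguments.
Unset Strict Implicit.
Unset Printing Implicit Defensive.

Import GRing.Theory.
Local Open Scope ring_scope.

(** The proof follows Dieudonne's method.  For a vector [w != 0], the matrices [M]
    of [V] with [f M *m w = 0] form a space of dimension at least [n^2 - 2n + 2];
    since [f M] is singular, so is [M].  A theorem of Atkinson and Lloyd
    ([singular_space_compressed]) describes singular spaces of that size: such a
    space has a common kernel vector, or a common left kernel vector, or it maps
    a subspace of dimension [n - 1] into one of dimension [n - 2], or a subspace
    of dimension [2] into one of dimension [1].

    The theorem is proved by putting a matrix of rank [n - 1] of the space in the
    form [diag(1, 0)] and writing the others as block matrices [X, v; u, 0].
    As [K] is infinite, the vanishing of the determinant yields
    [u *m X ^ k *m v = 0].  The relations for [k = 0, 1] bound the dimension of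
    the space of the [X] with [u = 0] and [v = 0] in terms of that of the space
    of the pairs [(u, v)]; if some pair has both components nonzero, the
    hypothesis on the dimension turns all inequalities into equalities, and
    [k = 2] then gives the last two cases.

    Fix two vectors [x] and [z] such that [(f M *m x, f M *m z)] takes all values;
    as [V] has codimension less than [n - 1], there is an [x] such that this
    holds for all [z] off some hyperplane ([onto_at_off_hyperplane]).  On the line
    [x + t z], one of the four cases occurs for infinitely many [t].  The last two
    cannot occur three times ([no_three_compressed2]).  If the first case
    occurs three times, then [M *m g = B *m f M *m x] and
    [M *m g' = B *m f M *m z] for fixed [g], [g'] and [B != 0]
    ([intertwined_plane]).  The second case is the first one for the transposed
    matrices, and for a given [x] a dimension count excludes that both occur
    ([intertwined_tr_excl]).  As [B] does not depend on [z] (up to a scalar), the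
    vectors [g'] assemble into a matrix [G] with [M *m G = B *m f M] on all of
    [V], and one more dimension count shows that [G] and [B] are invertible. *)

(** * Infinite fields and determinants of pencils *)

Section Infinite.
Variable K : fieldType.

(** [A] holds at infinitely many scalars, in the form in which it is used: outside
    of every finite sequence. *)
Definition unbounded (A : K -> Prop) : Prop :=
  forall s : seq K, exists2 t, t \notin s & A t.

Lemma unboundedT : infinite_set [set: K]%classic -> unbounded (fun=> True).
Proof.
move=> Kinf s; apply: contrapT => nex; apply: Kinf; apply/finite_seqP.
exists s; rewrite predeqE => t; split=> // _ /=; apply: contrapT => /negP ts.
by apply: nex; exists t.
Qed.

Lemma unbounded_or (A B : K -> Prop) :
  unbounded (fun t => A t \/ B t) -> unbounded A \/ unbounded B.
Proof.
move=> AB; apply: contrapT => /not_orP[/existsNP[s nA] /existsNP[s' nB]].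
have [t] := AB (s ++ s'); rewrite mem_cat negb_or => /andP[ts ts'] [At|Bt].
  by apply: nA; exists t.
by apply: nB; exists t.
Qed.

Lemma unbounded3 (A : K -> Prop) : unbounded A ->
  exists t1 t2 t3, [/\ A t1, A t2 & A t3] /\ [/\ t1 != t2, t1 != t3 & t2 != t3].
Proof.
move=> Ainf; have [t1 _ At1] := Ainf [::]; have [t2 nt2 At2] := Ainf [:: t1].
have [t3 nt3 At3] := Ainf [:: t1; t2]; exists t1, t2, t3.
move: nt2 nt3; rewrite !inE negb_or => n21 /andP[n31 n32].
by split; split; rewrite // eq_sym.
Qed.

Lemma poly_eq0_unbounded (p : {poly K}) :
  unbounded (fun t => root p t) -> p = 0.
Proof.
move=> proots; apply: contrapT => /eqP p_neq0.
have [s [us ss ps]] : exists s, [/\ uniq s, size s = size p & all (root p) s].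
  elim: (size p) => [|k [s [us ss ps]]]; first by exists [::].
  have [t ts pt] := proots s; exists (t :: s).
  by rewrite /= ts us ss pt.
by have := max_poly_roots p_neq0 ps us; rewrite ss ltnn.
Qed.

(** The determinant of a pencil is a polynomial in [s]; vanishing for [s != 0], it
    vanishes at [s = 0]. *)
Lemma det_pencil_eq0 n (A B : 'M[K]_n) :
    unbounded (fun=> True) ->
    (forall s, s != 0 -> \det (A + s *: B) = 0) ->
  \det A = 0.
Proof.
move=> Kinf det0; pose p := \det (map_mx polyC A + 'X *: map_mx polyC B).
have pE s : p.[s] = \det (A + s *: B).
  rewrite -[LHS]/(horner_eval s p) -det_map_mx; congr (\det _).
  by apply/matrixP=> i j; rewrite !mxE /= /horner_eval hornerD hornerM hornerX !hornerC.
have p0 : p = 0.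
  apply: poly_eq0_unbounded => s; have [t] := Kinf (0 :: s).
  rewrite inE negb_or => /andP[t0 ts] _; exists t => //.
  by rewrite /root pE det0.
by have := pE 0; rewrite p0 horner0 scale0r addr0.
Qed.

End Infinite.

(** * Dimensions of spaces of matrices *)

Section Dimensions.
Variable K : fieldType.

(** The linear map [N |-> D *m N *m C]. *)
Definition sandwich m n p q (D : 'M[K]_(m, n)) (C : 'M[K]_(p, q)) :
    'Hom('M[K]_(n, p), 'M[K]_(m, q)) :=
  linfun (mulmxr C \o mulmx D).

Lemma sandwichE m n p q (D : 'M[K]_(m, n)) (C : 'M[K]_(p, q)) N :
  sandwich D C N = D *m N *m C.
Proof. by rewrite lfunE. Qed.

Lemma dim_mx m n : \dim {:'M[K]_(m, n)} = (m * n)%N.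
Proof. by rewrite dimvf. Qed.

Lemma dim_ker_limg (U V : vectType K) (g : 'Hom(U, V)) :
  (\dim (lker g) + \dim (limg g) = \dim {:U})%N.
Proof. by have := limg_ker_dim g fullv; rewrite capfv. Qed.

Lemma dim_limg_inj (U V : vectType K) (g : 'Hom(U, V)) W :
  injective g -> \dim (g @: W) = \dim W.
Proof. by move=> /lker0P/eqP g0; apply: limg_dim_eq; rewrite g0 capv0. Qed.

Lemma lfun_col_mx m n (p : 'Hom('cV[K]_n, 'cV[K]_m)) :
  exists B, forall y, p y = B *m y.
Proof.
exists (lin1_mx (trmx \o p \o trmx))^T => y.
by apply: trmx_inj; rewrite trmx_mul trmxK mul_rV_lin1 /= trmxK.
Qed.

(** The inner dimension [r] is a variable, rather than [\rank D] itself, so that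
    the factors can be rewritten in expressions that mention [D]. *)
Lemma rank_factorization m n (D : 'M[K]_(m, n)) :
  exists r (D1 : 'M_(m, r)) (D2 : 'M_(r, n)) D1' D2',
    [/\ r = \rank D, D = D1 *m D2, D1' *m D1 = 1%:M & D2 *m D2' = 1%:M].
Proof.
exists (\rank D), (col_base D), (row_base D).
exists (pinvmx (col_base D)), (pinvmx (row_base D)).
split=> //; first by rewrite mulmx_base.
  by rewrite mulVpmx ?col_base_full.
by rewrite mulmxVp ?row_base_free.
Qed.

Lemma dim_limg_sandwich m n p q (D : 'M[K]_(m, n)) (C : 'M[K]_(p, q)) :
  \dim (limg (sandwich D C)) = (\rank D * \rank C)%N.
Proof.
have [d [D1 [D2 [D1' [D2' [<- defD D1K D2K]]]]]] := rank_factorization D.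
have [c [C1 [C2 [C1' [C2' [<- defC C1K C2K]]]]]] := rank_factorization C.
have s_inj : injective (sandwich D1 C2).
  move=> M N; rewrite !sandwichE => /(congr1 (fun A => D1' *m A *m C2')).
  by rewrite !mulmxA D1K !mul1mx -!(mulmxA _ C2) C2K !mulmx1.
rewrite -[RHS]dim_mx -(dim_limg_inj _ s_inj); congr (\dim _).
apply/eqP; rewrite eqEsubv.
apply/andP; split; apply/subvP => _ /memv_imgP[M _ ->].
  rewrite [X in X \in _](_ : _ = sandwich D1 C2 (D2 *m M *m C1)).
    by rewrite memv_img ?memvf.
  by rewrite !sandwichE -!mulmxA -defC (mulmxA D1 D2) -defD.
rewrite [X in X \in _](_ : _ = sandwich D C (D2' *m M *m C1')).
  by rewrite memv_img ?memvf.
have DD : D *m D2' = D1 by rewrite [in LHS]defD -mulmxA D2K mulmx1.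
have CC : C1' *m C = C2 by rewrite [in LHS]defC mulmxA C1K mul1mx.
by rewrite !sandwichE !mulmxA DD -(mulmxA _ C1') CC.
Qed.

Lemma dim_lker_sandwich m n p q (D : 'M[K]_(m, n)) (C : 'M[K]_(p, q)) :
  (\dim (lker (sandwich D C)) + \rank D * \rank C = n * p)%N.
Proof. by rewrite -dim_limg_sandwich dim_ker_limg dim_mx. Qed.

Lemma mem_lker_sandwich m n p q (D : 'M[K]_(m, n)) (C : 'M[K]_(p, q)) N :
  (N \in lker (sandwich D C)) = (D *m N *m C == 0).
Proof. by rewrite memv_ker sandwichE. Qed.

(** The coordinates of a basis, in rows, form a matrix of full row rank. *)
Lemma rank_mxvec_basis m n (A : {vspace 'M[K]_(m, n)}) :
  \rank (\matrix_i mxvec (tnth (vbasis A) i)) = \dim A.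
Proof.
apply/eqP; change (row_free (\matrix_i mxvec (tnth (vbasis A) i))).
apply/row_freeP => /=.
set B := \matrix_i _.
have : kermx B = 0.
  apply/row_matrixP=> i; rewrite row0; set c := row i _.
  have cB : c *m B = 0 by rewrite /c -row_mul mulmx_ker row0.
  have /freeP/(_ (c 0)) fr := basis_free (vbasisP A).
  apply/rowP=> j; rewrite [RHS]mxE; apply: fr.
  rewrite -[LHS]mxvecK -[RHS]mxvecK; congr vec_mx.
  rewrite linear_sum linear0 /= -[RHS]cB mulmx_sum_row; apply: eq_bigr => k _.
  by rewrite linearZ rowK /= (tnth_nth 0).
move/eqP; rewrite kermx_eq0 => /row_freeP[B' BB']; by exists B'.
Qed.

Lemma mxvec_mul_tr m n (A : 'M[K]_(m, n)) (B : 'M[K]_(n, m)) :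
  (mxvec A *m (mxvec B^T)^T) 0 0 = \tr (A *m B).
Proof.
rewrite mxE (reindex _ (curry_mxvec_bij _ _)) /= /mxtrace.
under [RHS]eq_bigr => i _ do rewrite mxE.
rewrite pair_bigA; apply: eq_bigr => [[i j]] _ /=.
by rewrite mxE !mxvecE mxE.
Qed.

(** Orthogonality for the nondegenerate pairing [\tr (a *m b)]. *)
Lemma trace_orthogonal_dim m n (A : {vspace 'M[K]_(m, n)})
    (B : {vspace 'M[K]_(n, m)}) :
    (forall a b, a \in A -> b \in B -> \tr (a *m b) = 0) ->
  (\dim A + \dim B <= m * n)%N.
Proof.
move=> AB; pose t : 'Hom('M[K]_(n, m), 'M[K]_(m, n)) := linfun trmx.
have t_inj : injective t by move=> M N; rewrite !lfunE /= => /trmx_inj.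
rewrite -(dim_limg_inj B t_inj) -(rank_mxvec_basis A).
rewrite -(rank_mxvec_basis (t @: B)).
rewrite -[X in (_ + X <= _)%N]mxrank_tr.
apply: mulmx0_rank_max; apply/matrixP=> i j; rewrite [RHS]mxE.
have /memv_imgP[b Bb] := vbasis_mem (mem_tnth j (vbasis (t @: B))).
rewrite lfunE /= => eb.
rewrite -(AB _ _ (vbasis_mem (mem_tnth i (vbasis A))) Bb) -mxvec_mul_tr -eb.
rewrite [LHS]mxE [RHS]mxE; apply: eq_bigr => k _.
by rewrite !mxE.
Qed.

End Dimensions.

(** * Spaces of singular matrices of large dimension *)

Section LinearAlgebra.
Variable K : fieldType.

Lemma row_right_inverse n (u : 'rV[K]_n) : u != 0 -> exists w, u *m w = 1%:M.
Proof. by move=> u0; exists (pinvmx u); rewrite mulmxVp // /row_free rank_rV u0. Qed.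

Lemma col_left_inverse n (v : 'cV[K]_n) : v != 0 -> exists w, w *m v = 1%:M.
Proof.
move=> v0; have vT0 : v^T != 0 by rewrite trmx_eq0.
have [w vw] := row_right_inverse vT0; exists w^T.
by apply: trmx_inj; rewrite trmx_mul trmxK vw trmx1.
Qed.

(** The matrices [v *m q.1 + q.2 *m u], for [q] in [Q], are trace-orthogonal to [T];
    they depend linearly on [q], and [v *m q.1 + q.2 *m u = 0] only if [q] is a
    multiple of [(u, - v)]. *)
Lemma isotropic_dim r (u : 'rV[K]_r) (v : 'cV[K]_r)
    (T : {vspace 'M[K]_r}) (Q : {vspace ('rV[K]_r * 'cV[K]_r)%type}) :
    u != 0 -> v != 0 ->
    (forall q M, q \in Q -> M \in T -> q.1 *m M *m v + u *m M *m q.2 = 0) ->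
  (\dim T + \dim Q <= r * r + 1)%N.
Proof.
move=> u0 v0 TQ.
pose pr1 : 'Hom(('rV[K]_r * 'cV[K]_r)%type, 'rV[K]_r) := linfun fst.
pose pr2 : 'Hom(('rV[K]_r * 'cV[K]_r)%type, 'cV[K]_r) := linfun snd.
pose phi := ((sandwich v 1%:M \o pr1) + (sandwich 1%:M u \o pr2))%VF.
have phiE q : phi q = v *m q.1 + q.2 *m u.
  by rewrite add_lfunE !comp_lfunE !sandwichE !lfunE /= mulmx1 mul1mx.
have [w uw] := row_right_inverse u0; have [w' wv] := col_left_inverse v0.
have kerQ : (\dim (Q :&: lker phi) <= 1)%N.
  suff sub : (Q :&: lker phi <= <[(u, - v)]>)%VS.
    by apply: leq_trans (dimvS sub) _; rewrite dim_vline; case: (_ == _).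
  apply/subvP=> [[u' v']] /memv_capP[_]; rewrite memv_ker phiE /= addr_eq0.
  move/eqP=> e; apply/vlineP; exists ((- (w' *m v')) 0 0).
  have eu : u' = - (w' *m v') *m u.
    by rewrite -[LHS]mul1mx -wv -mulmxA e mulmxN mulmxA mulNmx.
  have ev : v' = v *m (w' *m v').
    have : v' *m u *m w = - (v *m u') *m w by rewrite e opprK.
    rewrite -mulmxA uw mulmx1 => {1}->.
    by rewrite eu !mulNmx mulmxN mulNmx opprK -!mulmxA uw mulmx1.
  congr (_, _).
    by rewrite {1}eu [X in X *m u]mx11_scalar mul_scalar_mx.
  rewrite {1}ev [X in v *m X]mx11_scalar mul_mx_scalar [in RHS]mxE.
  by rewrite scaleNr scalerN opprK.
have orth : (\dim (phi @: Q) + \dim T <= r * r)%N.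
  apply: trace_orthogonal_dim => _ M /memv_imgP[q Qq ->] TM; rewrite phiE.
  rewrite mulmxDl linearD /=.
  rewrite -mulmxA mxtrace_mulC -[X in _ + \tr X]mulmxA [X in _ + X]mxtrace_mulC.
  by rewrite -linearD /= TQ // linear0.
rewrite -(limg_ker_dim phi Q) addnCA [X in (X <= _)%N]addnC leq_add //.
by rewrite addnC.
Qed.

Hypothesis Kinf : @unbounded K (fun=> True).

Lemma det_bordered1 r (v : 'cV[K]_r) (u : 'rV[K]_r) (d : 'M[K]_1) :
  \det (block_mx 1%:M v u d) = (d - u *m v) 0 0.
Proof.
have -> : block_mx 1%:M v u d =
    block_mx 1%:M 0 u 1%:M *m block_mx 1%:M v 0 (d - u *m v).
  rewrite mulmx_block !mulmx1 !mul1mx !mulmx0 !mul0mx !addr0.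
  by rewrite addrC subrK.
by rewrite det_mulmx det_lblock det_ublock !det1 !mul1r det_mx11.
Qed.

(** Iterating this lemma yields [u *m X ^+ k *m v = 0] for all [k]. *)
Lemma bordered_pencil r (X : 'M[K]_r) (v : 'cV[K]_r) (u : 'rV[K]_r) :
    (forall s, s != 0 -> \det (block_mx (1%:M + s *: X) v u 0) = 0) ->
  u *m v = 0 /\
  (forall s, s != 0 -> \det (block_mx (1%:M + s *: X) v (u *m X) 0) = 0).
Proof.
move=> det0; have uv0 : u *m v = 0.
  have : \det (block_mx 1%:M v u 0) = 0.
    apply: (@det_pencil_eq0 _ _ _ (block_mx X 0 0 0)) => // s s0.
    by rewrite scale_block_mx add_block_mx !scaler0 !addr0 det0.
  rewrite det_bordered1 sub0r mxE => /eqP; rewrite oppr_eq0 => /eqP e.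
  by rewrite [LHS]mx11_scalar e raddf0.
split=> // s s0; have := det0 s s0.
have : block_mx 1%:M 0 (- u) 1%:M *m block_mx (1%:M + s *: X) v u 0
     = block_mx 1%:M 0 0 (- s)%:M *m block_mx (1%:M + s *: X) v (u *m X) 0.
  rewrite !mulmx_block !mul1mx !mulmx0 !mul0mx !addr0 !add0r !mulNmx uv0 oppr0.
  rewrite mulmxDr mulmx1 opprD addrAC addNr add0r.
  by rewrite mul_scalar_mx scaleNr -scalemxAr.
move/(congr1 determinant); rewrite !det_mulmx !det_lblock !det1 !mul1r det_scalar1.
by move=> -> /eqP; rewrite mulf_eq0 oppr_eq0 (negPf s0) => /eqP.
Qed.

End LinearAlgebra.

Section Separation.
Variable K : fieldType.

Lemma separate_row m n (U : 'M[K]_(m, n)) (x : 'rV[K]_n) :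
  ~~ (x <= U)%MS -> exists2 c : 'cV_n, U *m c = 0 & x *m c = 1%:M.
Proof.
rewrite submxE => xU0.
have [w xUw] := row_right_inverse xU0.
by exists (cokermx U *m w); rewrite mulmxA ?mulmx_coker ?mul0mx.
Qed.

Lemma separate_col n (v x : 'cV[K]_n) :
  ~~ (x^T <= v^T)%MS -> exists2 c : 'rV_n, c *m v = 0 & c *m x = 1%:M.
Proof.
move=> /separate_row[c vc xc]; exists c^T; apply: trmx_inj.
  by rewrite trmx_mul trmxK vc trmx0.
by rewrite trmx_mul trmxK xc trmx1.
Qed.

Lemma separate_vspace n (W : {vspace 'cV[K]_n}) x : x \notin W ->
  exists2 c : 'rV_n, {in W, forall w, c *m w = 0} & c *m x = 1%:M.
Proof.
move=> xW; pose p := (\1 - projv W)%VF; have [B pE] := lfun_col_mx p.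
have [|w wx] := @col_left_inverse _ _ (p x).
  apply: contraNneq xW; rewrite add_lfunE opp_lfunE id_lfunE => /eqP.
  by rewrite subr_eq0 => /eqP ->; apply: memv_proj.
exists (w *m B); last by rewrite -mulmxA -pE.
move=> y Wy; rewrite -mulmxA -pE add_lfunE opp_lfunE id_lfunE projv_id //.
by rewrite subrr mulmx0.
Qed.

Lemma row_annihilator n b (phi : 'rV[K]_n) : n = (b + 1)%N -> phi != 0 ->
  exists2 E : 'M_(n, b), \rank E = b & phi *m E = 0.
Proof.
move=> en phi0; have eb : \rank (kermx phi^T) = b.
  by rewrite mxrank_ker mxrank_tr rank_rV phi0 en addnK.
rewrite -eb; exists (row_base (kermx phi^T))^T.
  by rewrite mxrank_tr; apply/eqP; apply: row_base_free.
apply: trmx_inj; rewrite trmx_mul trmxK trmx0; apply/eqP.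
by rewrite -sub_kermx eq_row_base.
Qed.

End Separation.

(** [L *m A *m E = 0] for all [A] in [S], where [L] has [a] independent rows and [E]
    has [b] independent columns: the matrices of [S] map a fixed subspace of
    dimension [b] into a fixed subspace of codimension [a].  Thus [a = n], [b = 1]
    is a common kernel vector, and [a = 1], [b = n] a common left kernel vector. *)
Definition compressed (K : fieldType) n (S : {vspace 'M[K]_n}) a b :=
  exists (L : 'M[K]_(a, n)) (E : 'M[K]_(n, b)),
    [/\ \rank L = a, \rank E = b & {in S, forall A, L *m A *m E = 0}].

Section Border.
Variables (K : fieldType) (r : nat).

(** For a block matrix [X, v; u, d] with [d] of size one, the pair [(u, v)]. *)
Definition border (A : 'M[K]_(r + 1)) : 'rV[K]_r * 'cV[K]_r :=
  (dlsubmx A, ursubmx A).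

Lemma border_is_linear : linear border.
Proof. by move=> a A B; congr (_, _); apply/matrixP=> i j; rewrite !mxE. Qed.

HB.instance Definition _ :=
  GRing.isLinear.Build K _ _ _ border border_is_linear.

(** The block matrix [M, 0; 0, 0]. *)
Definition corner (M : 'M[K]_r) : 'M[K]_(r + 1) := block_mx M 0 0 0.

Lemma corner_is_linear : linear corner.
Proof.
move=> a A B; rewrite /corner scale_block_mx add_block_mx.
by rewrite !scaler0 !addr0.
Qed.

HB.instance Definition _ :=
  GRing.isLinear.Build K _ _ _ corner corner_is_linear.

End Border.

Section CompressionNormalForm.
Variable K : fieldType.
Hypothesis Kinf : @unbounded K (fun=> True).
Variables (r : nat) (S : {vspace 'M[K]_(r + 1)}).
Hypothesis S_sing : forall A, A \in S -> \det A = 0.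
Hypothesis S_J : block_mx 1%:M 0 0 0 \in S.
Hypothesis S_dim : (r * r + 1 <= \dim S)%N.

Implicit Types (A B C : 'M[K]_(r + 1)) (M : 'M[K]_r).

Let corner0 A : A \in S -> drsubmx A = 0.
Proof.
move=> SA; have : \det (block_mx 1%:M 0 (dlsubmx A) (drsubmx A)) = 0.
  apply: (@det_pencil_eq0 _ _ _ (block_mx (ulsubmx A) (ursubmx A) 0 0)) => // s s0.
  rewrite scale_block_mx add_block_mx !scaler0 !addr0 add0r.
  have := S_sing (memvD S_J (memvZ s SA)).
  rewrite -{1}[A]submxK scale_block_mx add_block_mx !add0r.
  have -> : block_mx (1%:M + s *: ulsubmx A) (s *: ursubmx A)
      (s *: dlsubmx A) (s *: drsubmx A)
    = block_mx 1%:M 0 0 s%:M *m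
      block_mx (1%:M + s *: ulsubmx A) (s *: ursubmx A) (dlsubmx A) (drsubmx A).
    by rewrite mulmx_block !mul1mx !mul0mx !addr0 !add0r !mul_scalar_mx.
  rewrite det_mulmx det_lblock det1 mul1r det_scalar1 => /eqP.
  by rewrite mulf_eq0 (negPf s0) => /eqP.
rewrite det_bordered1 mulmx0 subr0 => e.
by rewrite [LHS]mx11_scalar e raddf0.
Qed.

(** For [s != 0], the matrix [corner 1%:M + s *: A] of [S] is singular, and the factors
    [s] of its last row and of its last column can be removed; then
    [bordered_pencil] applies three times. *)
Let relations A (u := dlsubmx A) (v := ursubmx A) (X := ulsubmx A) : A \in S ->
  [/\ u *m v = 0, u *m X *m v = 0 & u *m X *m X *m v = 0].
Proof.
move=> SA.
have [|uv0 det1] := @bordered_pencil _ Kinf _ X v u.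
  move=> s s0; have := S_sing (memvD S_J (memvZ s SA)).
  rewrite -{1}[A]submxK (corner0 SA).
  rewrite scale_block_mx add_block_mx scaler0 !add0r.
  have -> : block_mx (1%:M + s *: ulsubmx A) (s *: ursubmx A) (s *: dlsubmx A) 0
    = block_mx 1%:M 0 0 s%:M *m block_mx (1%:M + s *: X) v u 0
      *m block_mx 1%:M 0 0 s%:M.
    rewrite !mulmx_block !mul1mx !mulmx1 !mul0mx !mulmx0 !addr0 !add0r.
    by rewrite mul0mx !mul_scalar_mx !mul_mx_scalar.
  rewrite !det_mulmx !det_lblock !det1 !mul1r !det_scalar1 => /eqP.
  by rewrite !mulf_eq0 (negPf s0) orbF => /eqP.
have [uXv0 det2] := bordered_pencil Kinf det1.
by have [] := bordered_pencil Kinf det2.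
Qed.

(** The pairs [(u, v)] that border the matrices of [S], and the matrices [M] such that
    [corner M] is in [S]. *)
Let P := (linfun (@border K r) @: S)%VS.
Let T := (linfun (@corner K r) @^-1: S)%VS.

(** [T] is isomorphic to the kernel of [border] on [S]. *)
Let dimPT : (\dim P + \dim T = \dim S)%N.
Proof.
rewrite /P -(limg_ker_dim (linfun (@border K r)) S) addnC; congr addn.
rewrite -(@dim_limg_inj _ _ _ (linfun (@corner K r))); last first.
  move=> M N; rewrite !lfunE /= => /(congr1 ulsubmx).
  by rewrite !block_mxKul.
congr (\dim _); apply/vspaceP=> A; apply/idP/memv_capP.
  move=> /memv_imgP[M]; rewrite -memv_preim => SM ->; split=> //.
  by rewrite memv_ker !lfunE /= /border block_mxKdl block_mxKur.
move=> [SA]; rewrite memv_ker lfunE /= => /eqP[e1 e2].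
have -> : A = linfun (@corner K r) (ulsubmx A).
  by rewrite lfunE /= /corner -[LHS]submxK e1 e2 (corner0 SA).
apply: memv_img; rewrite -memv_preim lfunE /= /corner.
by rewrite -{1}e1 -{1}e2 -{1}(corner0 SA) submxK.
Qed.

Let PE A : A \in S -> (dlsubmx A, ursubmx A) \in P.
Proof. by move=> SA; have := memv_img (linfun (@border K r)) SA; rewrite lfunE. Qed.

Let PP q : q \in P -> exists2 A, A \in S & q = (dlsubmx A, ursubmx A).
Proof. by move=> /memv_imgP[A SA ->]; exists A => //; rewrite lfunE. Qed.

Let TE M : (M \in T) = (corner M \in S).
Proof. by rewrite -memv_preim lfunE. Qed.

Let ulC A M : ulsubmx (A + corner M) = ulsubmx A + M.
Proof. by rewrite -{1}[A]submxK /corner add_block_mx block_mxKul. Qed.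

Let dlC A M : dlsubmx (A + corner M) = dlsubmx A.
Proof. by rewrite -{1}[A]submxK /corner add_block_mx block_mxKdl addr0. Qed.

Let urC A M : ursubmx (A + corner M) = ursubmx A.
Proof. by rewrite -{1}[A]submxK /corner add_block_mx block_mxKur addr0. Qed.

Let PT q M : q \in P -> M \in T -> q.1 *m M *m q.2 = 0.
Proof.
move=> /PP[A SA -> /=]; rewrite TE => SM.
have [_ uXv _] := relations SA; have [_] := relations (memvD SA SM).
by rewrite ulC dlC urC mulmxDr mulmxDl uXv add0r.
Qed.

Let PPT q q' M : q \in P -> q' \in P -> M \in T ->
  q.1 *m M *m q'.2 + q'.1 *m M *m q.2 = 0.
Proof.
move=> Pq Pq' TM; have := PT (memvD Pq Pq') TM.
rewrite /= !mulmxDl !mulmxDr PT // (PT Pq' TM) add0r addr0.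
by rewrite addrC.
Qed.

(** Adding [(u, 0)] and [(0, v)] to [P] preserves the hypothesis of [isotropic_dim], and
    so does adding to [T] a matrix orthogonal to [P] in the sense of that lemma.
    As [\dim P + \dim T] already reaches the bound [r * r + 1], neither space can
    grow. *)
Let split_pairs q0 : q0 \in P -> q0.1 != 0 -> q0.2 != 0 ->
  [/\ (q0.1, 0) \in P, (0, q0.2) \in P &
    forall M, (forall q, q \in P -> q.1 *m M *m q0.2 + q0.1 *m M *m q.2 = 0) ->
      M \in T].
Proof.
case: q0 => u v Puv /= u0 v0.
pose qu : 'rV[K]_r * 'cV[K]_r := (u, 0).
pose qv : 'rV[K]_r * 'cV[K]_r := (0, v).
pose Q := (P + (<[qu]> + <[qv]>))%VS.
have dimQ : (\dim T + \dim Q <= r * r + 1)%N.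
  apply: (isotropic_dim u0 v0) => _ M /memv_addP[q Pq [_ /memv_addP[_
    /vlineP[a ->] [_ /vlineP[b ->] ->] ->]]] TM /=.
  have /= uMv := PT Puv TM.
  rewrite !scaler0 !(add0r, addr0) !(mulmxDl, mulmxDr) -!scalemxAl -!scalemxAr.
  by rewrite uMv !scaler0 !addr0; apply: (@PPT q (u, v)).
have QP : Q = P.
  apply/esym/eqP; rewrite eqEdim addvSl /=.
  by move: dimQ dimPT S_dim; lia.
split.
- rewrite -QP -[_ \in _]/(qu \in _); apply: subvP (memv_line qu).
  exact: subv_trans (addvSl _ _) (addvSr _ _).
- rewrite -QP -[_ \in _]/(qv \in _); apply: subvP (memv_line qv).
  exact: subv_trans (addvSr _ _) (addvSr _ _).
move=> M PM; suff : (T + <[M]> <= T)%VS by rewrite subv_add => /andP[_].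
have TM : (T <= T + <[M]>)%VS by apply: addvSl.
rewrite -(geq_leqif (dimv_leqif_sup TM)).
suff : (\dim (T + <[M]>) + \dim P <= r * r + 1)%N by move: dimPT S_dim; lia.
apply: (isotropic_dim u0 v0) => q _ Pq /memv_addP[N TN [_ /vlineP[a ->] ->]].
rewrite !(mulmxDl, mulmxDr) -!scalemxAr -!scalemxAl addrACA.
by rewrite -scalerDr PM // scaler0 addr0; apply: (@PPT q (u, v)).
Qed.

(** If the rows [u] and the columns [v] both span at least two dimensions, there are a
    pair [(u', v')] in [P] and a matrix [c *m d] in [T] with [u' *m (c *m d) *m v'] not
    zero, which [PT] forbids. *)
Lemma border_dichotomy :
  [\/ compressed S 1 (r + 1), compressed S (r + 1) 1 |
   exists2 C, C \in S & [/\ dlsubmx C != 0, ursubmx C != 0 &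
     {in S, forall A, (dlsubmx A <= dlsubmx C)%MS} \/
     {in S, forall A, ((ursubmx A)^T <= (ursubmx C)^T)%MS}]].
Proof.
have [dl0|/existsNP[B /not_implyP[SB /eqP dlB]]] :=
    pselect (forall A, A \in S -> dlsubmx A = 0).
  constructor 1; exists (row_mx 0 1%:M), 1%:M; split.
  - by rewrite rank_row_0mx mxrank1.
  - by rewrite mxrank1.
  move=> A SA; rewrite mulmx1 -[A]submxK dl0 // corner0 // mul_row_block.
  by rewrite !mulmx0 !mul0mx !addr0 row_mx0.
have [ur0|/existsNP[B' /not_implyP[SB' /eqP urB']]] :=
    pselect (forall A, A \in S -> ursubmx A = 0).
  constructor 2; exists 1%:M, (col_mx 0 1%:M); split.
  - by rewrite mxrank1.
  - by rewrite rank_col_0mx mxrank1.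
  move=> A SA; rewrite mul1mx -[A]submxK ur0 // corner0 // mul_block_col.
  by rewrite !mulmx0 !mul0mx !addr0 col_mx0.
constructor 3.
have [C SC [dlC0 urC0]] : exists2 C, C \in S & dlsubmx C != 0 /\ ursubmx C != 0.
  have [urB|] := eqVneq (ursubmx B) 0; last by exists B.
  have [dlB'|] := eqVneq (dlsubmx B') 0; last by exists B'.
  have e1 : dlsubmx (B + B') = dlsubmx B + dlsubmx B'.
    by apply/matrixP=> i j; rewrite !mxE.
  have e2 : ursubmx (B + B') = ursubmx B + ursubmx B'.
    by apply/matrixP=> i j; rewrite !mxE.
    exists (B + B'); first by rewrite memvD.
  by rewrite e1 e2 dlB' urB addr0 add0r.
exists C => //; split=> //; apply: contrapT => /not_orP[].
move=> /existsNP[A /not_implyP[SA /negP nA]].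
move=> /existsNP[B1 /not_implyP[SB1 /negP nB1]].
have [c uc Ac] := separate_row nA; have [d dv Bd] := separate_col nB1.
have [_ _ full] := split_pairs (PE SC) dlC0 urC0.
have PA : (dlsubmx A, 0) \in P.
  have [ur0|ur0] := eqVneq (ursubmx A) 0; first by rewrite -ur0 PE.
  have dl0 : dlsubmx A != 0 by apply: contraNneq nA => ->; rewrite sub0mx.
  by have [] := split_pairs (PE SA) dl0 ur0.
have PB : (0, ursubmx B1) \in P.
  have [dl0|dl0] := eqVneq (dlsubmx B1) 0; first by rewrite -dl0 PE.
  have ur0 : ursubmx B1 != 0 by apply: contraNneq nB1 => ->; rewrite trmx0 sub0mx.
  by have [] := split_pairs (PE SB1) dl0 ur0.
have Tcd : c *m d \in T.
  by apply: full => q _ /=; rewrite -!mulmxA dv !mulmx0 add0r !mulmxA uc !mul0mx.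
have := PT (memvD PA PB) Tcd; rewrite /= addr0 add0r mulmxA Ac mul1mx Bd.
by move/matrixP/(_ 0 0)/eqP; rewrite !mxE oner_eq0.
Qed.

(** If all the rows [dlsubmx A] are multiples of [u := dlsubmx C], then the columns
    [ursubmx A] fill the kernel of [u], and [u *m ulsubmx A] vanishes on this kernel. *)
Lemma compressed_line C : C \in S -> dlsubmx C != 0 -> ursubmx C != 0 ->
    {in S, forall A, (dlsubmx A <= dlsubmx C)%MS} ->
  (1 < r)%N /\ compressed S 2 r.
Proof.
move=> SC; set u := dlsubmx C; set v := ursubmx C => u0 v0 dlu.
have [uv _ _] := relations SC; rewrite -/u -/v in uv.
have r_gt1 : (1 < r)%N.
  have := mulmx0_rank_max uv; rewrite rank_rV u0 -mxrank_tr rank_rV trmx_eq0 v0.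
  by [].
split=> //.
have [_ _ full] := split_pairs (PE SC) u0 v0; rewrite /= -/u -/v in full.
have TuP M : (forall A, A \in S -> u *m M *m ursubmx A = 0) -> corner M \in S.
  move=> uM; rewrite -TE; apply: full => _ /PP[A SA ->] /=.
  have /submxP[k ->] := dlu A SA; rewrite uM // addr0.
  by rewrite -!mulmxA -/v [u *m _]mulmxA uM // mulmx0.
have eqA A : A \in S -> exists k, dlsubmx A = k *: u.
  by move=> /dlu/submxP[k ->]; exists (k 0 0); rewrite -mul_scalar_mx -mx11_scalar.
(* Apply [relations] to [A] and to [A + corner (z *m a)], where [a *m ursubmx A = 1]. *)
have step A (z : 'cV_r) : A \in S -> dlsubmx A != 0 -> ursubmx A != 0 -> u *m z = 0 ->
    u *m ulsubmx A *m z = 0.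
  move=> SA dlA urA uz; have [a aw] := col_left_inverse urA.
  have SM : corner (z *m a) \in S.
    by apply: TuP => B _; rewrite mulmxA uz !mul0mx.
  have [k ek] := eqA A SA; have k0 : k != 0.
    by apply: contraNneq dlA => k0; rewrite ek k0 scale0r.
  have [_ _] := relations SA; have [_ _] := relations (memvD SA SM).
  rewrite ulC dlC urC ek -!scalemxAl => /eqP.
  rewrite scalemx_eq0 (negPf k0) => /eqP e1 /eqP.
  rewrite scalemx_eq0 (negPf k0) => /eqP e2; move: e1.
  rewrite [u *m (_ + _)]mulmxDr mulmxA uz mul0mx addr0.
  by rewrite mulmxDr mulmxDl e2 add0r !mulmxA -mulmxA aw mulmx1.
(* [A] is a combination of [C] and of [A + s *: C], whose borders are nonzero for a
   suitable [s]. *)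
have uXz A (z : 'cV_r) : A \in S -> u *m z = 0 -> u *m ulsubmx A *m z = 0.
  move=> SA uz; have [k ek] := eqA A SA; have [b bv] := col_left_inverse v0.
  have [s] := Kinf [:: - k; - (b *m ursubmx A) 0 0].
  rewrite !inE negb_or => /andP[sk sb] _.
  have SAC := memvD SA (memvZ s SC).
  have e1 : dlsubmx (A + s *: C) = dlsubmx A + s *: dlsubmx C.
    by apply/matrixP=> i j; rewrite !mxE.
  have e2 : ursubmx (A + s *: C) = ursubmx A + s *: ursubmx C.
    by apply/matrixP=> i j; rewrite !mxE.
  have e3 : ulsubmx (A + s *: C) = ulsubmx A + s *: ulsubmx C.
    by apply/matrixP=> i j; rewrite !mxE.
  have := step _ z SAC; rewrite e1 e2 e3 /= -/u -/v ek -scalerDl.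
  rewrite scalemx_eq0 negb_or u0 andbT addrC addr_eq0 sk => /(_ isT).
  have -> : ursubmx A + s *: v != 0.
    apply: contraNneq sb => /(congr1 (fun x => (b *m x) 0 0)).
    rewrite mulmxDr -scalemxAr bv mulmx0 !mxE eqxx mulr1 => /eqP.
    by rewrite addrC addr_eq0.
  move=> /(_ isT uz); rewrite mulmxDr mulmxDl -scalemxAr -scalemxAl.
  by rewrite (step C) // scaler0 addr0.
pose W : {vspace 'cV[K]_r} := (linfun snd @: P)%VS.
have Wu A : A \in S -> ursubmx A \in W.
  by move=> /PE/(memv_img (linfun snd)); rewrite lfunE.
have uW (z : 'cV_r) : u *m z = 0 -> z \in W.
  move=> uz; apply: contrapT => /negP/separate_vspace[a aW az].
  have [k uk] := row_right_inverse u0; have [b bv] := col_left_inverse v0.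
  have aP A : A \in S -> a *m ursubmx A = 0 by move=> /Wu/aW.
  have [_ _ uXXv] := relations SC; rewrite -/u -/v in uXXv.
  have aXv : a *m ulsubmx C *m v = 0.
    have SM : corner (k *m a) \in S.
      by apply: TuP => A SA; rewrite mulmxA uk mul1mx aP.
    have [_ _] := relations (memvD SC SM); rewrite ulC dlC urC -/u -/v.
    rewrite -mulmxA [(_ + _) *m v]mulmxDl -[k *m a *m v]mulmxA aP // mulmx0 addr0.
    by rewrite mulmxDr mulmxDl !mulmxA uXXv uk mul1mx add0r.
  (* With [M = k *m a + z *m b], [u *m (X + M) *m (X + M) *m v] reduces to [a *m z = 1]. *)
  have SM : corner (k *m a + z *m b) \in S.
    by apply: TuP => A SA; rewrite mulmxDr !mulmxA uk uz mul1mx mul0mx addr0 aP.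
  have [_ _] := relations (memvD SC SM); rewrite ulC dlC urC -/u -/v.
  rewrite -mulmxA [(_ + _) *m v]mulmxDl [(_ + z *m b) *m v]mulmxDl.
  rewrite -[k *m a *m v]mulmxA aP // mulmx0 add0r -[z *m b *m v]mulmxA bv mulmx1.
  rewrite !mulmxDr !mulmxDl !mulmxA uXXv uk uz mul1mx !mul0mx uXz // aXv az.
  by rewrite !(addr0, add0r) => /matrixP/(_ 0 0)/eqP; rewrite !mxE oner_eq0.
have phi0 : row_mx u 0 != 0 :> 'rV_(r + 1).
  by apply: contraNneq u0 => /(congr1 lsubmx); rewrite row_mxKl linear0 => ->.
have [E rE] := row_annihilator (erefl _) phi0.
rewrite -[E]vsubmxK mul_row_col mul0mx addr0 => uE.
pose L : 'M_(1 + 1, r + 1) := block_mx u 0 0 1%:M.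
have rL : \rank L = 2 by rewrite rank_diag_block_mx mxrank1 rank_rV u0.
suff LE : {in S, forall A, L *m A *m E = 0} by exists L, E.
move=> A SA; rewrite -[E]vsubmxK -[A]submxK corner0 // mulmx_block mul_block_col.
rewrite !mul0mx !mul1mx !(addr0, add0r) mul0mx addr0.
have [k ek] := eqA A SA; have T1 : 1%:M \in T by rewrite TE.
have uw : u *m ursubmx A = 0.
  have := PPT (PE SA) (PE SC) T1; rewrite /= !mulmx1 -/u -/v ek.
  by rewrite -scalemxAl uv scaler0 add0r.
rewrite uw mul0mx addr0 ek -scalemxAl uE scaler0.
rewrite (_ : u *m ulsubmx A *m usubmx E = 0) ?col_mx0 //.
apply/matrixP=> i j; rewrite [RHS]mxE.
transitivity ((u *m ulsubmx A *m col j (usubmx E)) i 0).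
  by rewrite !mxE; apply: eq_bigr => l _; rewrite [col _ _ _ _]mxE.
by rewrite uXz ?mxE // colE mulmxA uE mul0mx.
Qed.

End CompressionNormalForm.

Section AtkinsonLloyd.
Variable K : fieldType.

Lemma compressedW n (S S' : {vspace 'M[K]_n}) a b :
  (S <= S')%VS -> compressed S' a b -> compressed S a b.
Proof.
move=> /subvP SS' [L [E [rL rE LE]]]; exists L, E; split=> // A /SS'.
exact: LE.
Qed.

Lemma compressed_sandwich n (P Q : 'M[K]_n) (S : {vspace 'M[K]_n}) a b :
    P \in unitmx -> Q \in unitmx ->
  compressed (sandwich P Q @: S) a b -> compressed S a b.
Proof.
move=> Pu Qu [L [E [rL rE LE]]]; exists (L *m P), (Q *m E); split.
- by rewrite mxrankMfree // row_free_unit.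
- by rewrite eqmxMfull // row_full_unit.
move=> A SA; have := LE _ (memv_img (sandwich P Q) SA).
by rewrite sandwichE !mulmxA.
Qed.

Lemma compressed_tr n (S : {vspace 'M[K]_n}) a b :
  compressed S a b -> compressed (linfun trmx @: S) b a.
Proof.
move=> [L [E [rL rE LE]]]; exists E^T, L^T; split; rewrite ?mxrank_tr //.
move=> _ /memv_imgP[A SA ->]; rewrite lfunE /=.
by apply: trmx_inj; rewrite !trmx_mul !trmxK trmx0 mulmxA LE.
Qed.

Lemma limg_trmxK n (S : {vspace 'M[K]_n}) :
  (linfun trmx @: (linfun trmx @: S))%VS = S.
Proof.
rewrite -limg_comp -[RHS]lim1g; congr (_ @: _)%VS; apply/lfunP=> A.
by rewrite comp_lfunE !lfunE /= trmxK.
Qed.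

Lemma trmx_lfun_inj m n :
  injective (linfun trmx : 'Hom('M[K]_(m, n), 'M[K]_(n, m))).
Proof. by move=> A B; rewrite !lfunE /= => /trmx_inj. Qed.

Lemma sandwich_inj n (P Q : 'M[K]_n) :
  P \in unitmx -> Q \in unitmx -> injective (sandwich P Q).
Proof.
move=> Pu Qu A B; rewrite !sandwichE => /(can_inj (mulmxK Qu)).
by move/(can_inj (mulKmx Pu)).
Qed.

Hypothesis Kinf : @unbounded K (fun=> True).

Lemma singular_space_rank_compressed r (S : {vspace 'M[K]_(r + 1)}) :
    {in S, forall A, \det A = 0} -> (r * r + 1 <= \dim S)%N ->
    (exists2 A, A \in S & \rank A = r) ->
  [\/ compressed S 1 (r + 1), compressed S (r + 1) 1,
      (1 < r)%N /\ compressed S 2 r | (1 < r)%N /\ compressed S r 2].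
Proof.
move=> S0 dimS [A0 SA0 rA0].
pose P := invmx (col_ebase A0); pose Q := invmx (row_ebase A0).
have Pu : P \in unitmx by rewrite unitmx_inv col_ebase_unit.
have Qu : Q \in unitmx by rewrite unitmx_inv row_ebase_unit.
pose S' := (sandwich P Q @: S)%VS.
have S'0 A : A \in S' -> \det A = 0.
  by move=> /memv_imgP[B SB ->]; rewrite sandwichE !det_mulmx (S0 B) // mulr0 mul0r.
have S'J : block_mx 1%:M 0 0 0 \in S'.
  have := memv_img (sandwich P Q) SA0; rewrite sandwichE -[A0 in P *m A0]mulmx_ebase.
  rewrite !mulmxA mulVmx ?col_ebase_unit // mul1mx -mulmxA mulmxV ?row_ebase_unit //.
  by rewrite mulmx1 rA0 pid_mx_block.
have dimS' : (r * r + 1 <= \dim S')%N by rewrite dim_limg_inj //; apply: sandwich_inj.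
have back a b : compressed S' a b -> compressed S a b by apply: compressed_sandwich.
have [|/back|[C SC [dlC urC [dlP|urP]]]] := border_dichotomy Kinf S'0 S'J dimS'.
- by move/back=> ?; constructor 1.
- by constructor 2.
- have [r1 /back ?] := compressed_line Kinf S'0 S'J dimS' SC dlC urC dlP.
  by constructor 3.
(* If the columns span a line, the rows of the transposed matrices do. *)
pose S2 := (linfun trmx @: S')%VS.
have S20 A : A \in S2 -> \det A = 0.
  by move=> /memv_imgP[B SB ->]; rewrite lfunE /= det_tr S'0.
have S2J : block_mx 1%:M 0 0 0 \in S2.
  have := memv_img (linfun trmx) S'J.
  by rewrite lfunE /= tr_block_mx !trmx0 trmx1.
have dimS2 : (r * r + 1 <= \dim S2)%N by rewrite dim_limg_inj //; apply: trmx_lfun_inj.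
have S2C : C^T \in S2 by have := memv_img (linfun trmx) SC; rewrite lfunE.
have [| | |r1 /compressed_tr] := compressed_line Kinf S20 S2J dimS2 S2C.
- by rewrite -trmx_ursub trmx_eq0.
- by rewrite -trmx_dlsub trmx_eq0.
- move=> _ /memv_imgP[B SB ->]; rewrite lfunE /= -!trmx_ursub.
  exact: urP.
by rewrite limg_trmxK => /back ?; constructor 4.
Qed.

(** The theorem of Atkinson and Lloyd for singular square matrices.  If all ranks are
    less than [r], a matrix of rank one can be added to the space, which stays
    singular. *)
Lemma singular_space_compressed r (S : {vspace 'M[K]_(r + 1)}) :
    {in S, forall A, \det A = 0} -> (r * r + 1 <= \dim S)%N ->
  [\/ compressed S 1 (r + 1), compressed S (r + 1) 1,
      (1 < r)%N /\ compressed S 2 r | (1 < r)%N /\ compressed S r 2].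
Proof.
have [k] := ubnP ((r + 1) * (r + 1) - \dim S)%N.
elim: k S => // k IHk S dimk S0 dimS.
have rS A : A \in S -> (\rank A <= r)%N.
  move=> SA; rewrite -ltnS -[X in (_ < X)%N]addn1 ltn_neqAle rank_leq_row andbT.
  apply/eqP=> rA; have : row_free A by apply/eqP.
  by rewrite row_free_unit unitmxE S0 // unitr0.
have [|low] := pselect (exists2 A, A \in S & \rank A = r).
  exact: singular_space_rank_compressed.
have {low}rS A : A \in S -> (\rank A < r)%N.
  move=> SA; rewrite ltn_neqAle rS // andbT; apply/eqP=> rA.
  by apply: low; exists A.
have [i [j dS]] : exists i j, delta_mx i j \notin S.
  apply: contrapT => nex; have : (1%:M : 'M[K]_(r + 1)) \in S.
    rewrite [1%:M]matrix_sum_delta; apply: rpred_sum => i _; apply: rpred_sum => j _.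
    by apply: memvZ; apply: contrapT => /negP dS; apply: nex; exists i, j.
  by move=> /S0/eqP; rewrite det1 oner_eq0.
pose S' := (S + <[delta_mx i j]>)%VS.
have SS' : (S <= S')%VS by apply: addvSl.
have dimS' : (\dim S < \dim S')%N.
  rewrite ltnNge (geq_leqif (dimv_leqif_sup SS')).
  by apply: contra dS => /subvP; apply; apply: subvP (addvSr _ _) _ (memv_line _).
have S'0 : {in S', forall A, \det A = 0}.
  move=> _ /memv_addP[A SA [_ /vlineP[a ->] ->]].
  apply/eqP; rewrite -[_ == 0]negbK -unitfE -unitmxE -row_full_unit /row_full neq_ltn.
  apply/orP; left; rewrite [X in (_ < X)%N]addn1 ltnS.
  apply: leq_trans (mxrank_add _ _) _.
  apply: leq_trans (leq_add (leqnn _) (mxrank_scale _ _)) _.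
  by rewrite mxrank_delta [X in (X <= _)%N]addn1 rS.
have S'd : (\dim S' <= (r + 1) * (r + 1))%N by rewrite -(dim_mx K) dimvS // subvf.
have [||||[r1]|[r1]] := IHk S' _ S'0.
- by lia.
- by lia.
- by move=> ?; constructor 1; apply: compressedW SS' _.
- by move=> ?; constructor 2; apply: compressedW SS' _.
- by move=> ?; constructor 3; split=> //; apply: compressedW SS' _.
by move=> ?; constructor 4; split=> //; apply: compressedW SS' _.
Qed.

End AtkinsonLloyd.

(** * Large spaces of matrices acting on a plane *)

Section Evaluation.
Variables (K : fieldType) (X : vectType K) (n : nat).
Implicit Types (f i : 'Hom(X, 'M[K]_n)) (x z w : 'cV[K]_n).

(** Evaluation of the matrices of the family [f] at the vector [w]. *)
Definition ev f w : 'Hom(X, 'cV[K]_n) := (sandwich 1%:M w \o f)%VF.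

Lemma evE f w M : ev f w M = f M *m w.
Proof. by rewrite comp_lfunE sandwichE mul1mx. Qed.

Lemma mem_lker_ev f w M : (M \in lker (ev f w)) = (f M *m w == 0).
Proof. by rewrite memv_ker evE. Qed.

(** The values at [x] and [z] of the matrices of the family [f] are jointly arbitrary. *)
Definition onto_at2 f x z := forall a b, exists2 M, f M *m x = a & f M *m z = b.

Lemma onto_at2_comb f x z a b c d : a * d - b * c != 0 ->
  onto_at2 f x z -> onto_at2 f (a *: x + b *: z) (c *: x + d *: z).
Proof.
set D := _ - _ => D0 fxz p q.
have [M e1 e2] := fxz (D^-1 *: (d *: p - b *: q)) (D^-1 *: (a *: q - c *: p)).
exists M; rewrite mulmxDr -!scalemxAr e1 e2; apply: (scalerI D0);
  by apply/matrixP=> j k; rewrite !mxE /D; field.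
Qed.

Lemma onto_at2_sym f x z : onto_at2 f x z -> onto_at2 f z x.
Proof. by move=> fxz a b; have [M e1 e2] := fxz b a; exists M. Qed.

Lemma limg_ev_onto f w : (forall a, exists M, f M *m w = a) -> limg (ev f w) = fullv.
Proof.
move=> onto; apply/eqP; rewrite eqEsubv subvf; apply/subvP=> a _.
have [M <-] := onto a; rewrite -evE; exact: memv_img (memvf _).
Qed.

Lemma dim_lker_ev f w : (forall a, exists M, f M *m w = a) ->
  (\dim (lker (ev f w)) + n = \dim {:X})%N.
Proof.
move=> /limg_ev_onto onto.
by rewrite -(dim_ker_limg (ev f w)) onto (dim_mx K) muln1.
Qed.

Lemma onto_at2_left f x z : onto_at2 f x z -> forall a, exists M, f M *m x = a.
Proof. by move=> fxz a; have [M e _] := fxz a 0; exists M. Qed.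

Lemma dim_lker_ev2 f x z : onto_at2 f x z ->
  (\dim (lker (ev f x) :&: lker (ev f z)) + 2 * n = \dim {:X})%N.
Proof.
move=> fxz; rewrite mul2n -addnn addnA -(dim_lker_ev (onto_at2_left fxz)).
rewrite -(limg_ker_dim (ev f z) (lker (ev f x))); congr (_ + _ + _)%N.
have -> : (ev f z @: lker (ev f x))%VS = fullv.
  apply/eqP; rewrite eqEsubv subvf; apply/subvP=> a _.
  have [M e1 e2] := fxz 0 a; rewrite -e2 -evE memv_img //.
  by rewrite mem_lker_ev e1.
by rewrite (dim_mx K) muln1.
Qed.

Lemma lfun_factor_mx (a b : 'Hom(X, 'cV[K]_n)) :
    limg a = fullv -> (forall M, a M = 0 -> b M = 0) ->
  exists B, forall M, b M = B *m a M.
Proof.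
move=> a_onto ab; have [B BE] := lfun_col_mx (b \o a^-1)%VF.
exists B => M; rewrite -BE comp_lfunE; apply/eqP; rewrite -subr_eq0 -linearB.
apply/eqP; apply: ab; rewrite linearB /= limg_lfunVK ?subrr //.
by rewrite a_onto memvf.
Qed.

Lemma common_kernel_dim f (E : {vspace X}) m (G : 'M[K]_(n, m)) :
    injective f -> (forall M, M \in E -> f M *m G = 0) ->
  (\dim E + n * \rank G <= n * n)%N.
Proof.
move=> f_inj EG; rewrite -(dim_lker_sandwich 1%:M G) mxrank1 leq_add2r.
rewrite -(dim_limg_inj E f_inj) dimvS //; apply/subvP=> _ /memv_imgP[M EM ->].
by rewrite mem_lker_sandwich mul1mx EG.
Qed.

End Evaluation.

Section Plane.
Variables (K : fieldType) (X : vectType K) (r : nat).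
Let n := (r + 1)%N.
Variables (i f : 'Hom(X, 'M[K]_n)).
Hypothesis i_inj : injective i.
Hypothesis dimX : (n * n + 2 <= \dim {:X} + n)%N.

(** The spaces of matrices [i M] with [f M *m w_k = 0] are, for dimension reasons, equal
    to the spaces [R_k] of all [A] with [L_k *m A *m E_k = 0].  The intersection of
    [R_1] and [R_2] lies in [R_3], while [R_1] and [R_3], as well as [R_2] and [R_3],
    intersect in dimension [n * n - 3 * n + 2]. *)
Lemma no_three_compressed2 w1 w2 w3 :
    (1 < r)%N -> onto_at2 f w1 w3 -> onto_at2 f w2 w3 ->
    (forall M, f M *m w1 = 0 -> f M *m w2 = 0 -> f M *m w3 = 0) ->
  compressed (i @: lker (ev f w1)) 2 r ->
  compressed (i @: lker (ev f w2)) 2 r ->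
  compressed (i @: lker (ev f w3)) 2 r -> False.
Proof.
move=> r1 g13 g23 dep [L1 [E1 [rL1 rE1 LE1]]] [L2 [E2 [rL2 rE2 LE2]]].
move=> [L3 [E3 [rL3 rE3 LE3]]].
have full w (L : 'M_(2, n)) (E : 'M_(n, r)) : (forall a, exists M, f M *m w = a) ->
    \rank L = 2 -> \rank E = r ->
    {in (i @: lker (ev f w))%VS, forall A, L *m A *m E = 0} ->
    (i @: lker (ev f w))%VS = lker (sandwich L E) /\
    (\dim {:X} + n = n * n + 2)%N.
  move=> onto rL rE LE; have sub : (i @: lker (ev f w) <= lker (sandwich L E))%VS.
    by apply/subvP=> A /LE; rewrite mem_lker_sandwich => ->.
  have := dim_lker_sandwich L E; have := dimvS sub; have := dim_lker_ev onto.
  rewrite dim_limg_inj // rL rE => d1 d2 d3.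
  have en : n = (r + 1)%N by [].
  split; last by lia.
  by apply/eqP; rewrite eqEdim sub dim_limg_inj //=; lia.
have [F1 dX] := full _ _ _ (onto_at2_left g13) rL1 rE1 LE1.
have [F2 _] := full _ _ _ (onto_at2_left g23) rL2 rE2 LE2.
have [F3 _] := full _ _ _ (onto_at2_left (onto_at2_sym g13)) rL3 rE3 LE3.
have en : n = (r + 1)%N by [].
have i0 : lker i == 0%VS by apply/lker0P.
have [phi phi0 phiE1] : exists2 phi : 'rV_n, phi != 0 & phi *m E1 = 0.
  exists (nz_row (kermx E1)).
    by rewrite nz_row_eq0 -mxrank_eq0 mxrank_ker rE1 /n addKn.
  by apply/eqP; rewrite -sub_kermx nz_row_sub.
have dim23 := dim_lker_ev2 g23; have dim13 := dim_lker_ev2 g13.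
rewrite -(dim_limg_inj _ i_inj) lker0_img_cap // F2 F3 in dim23.
rewrite -(dim_limg_inj _ i_inj) lker0_img_cap // F1 F3 in dim13.
have incl A : L1 *m A *m E1 = 0 -> L2 *m A *m E2 = 0 -> L3 *m A *m E3 = 0.
  move=> A1 A2; apply: LE3.
  have : A \in (i @: (lker (ev f w1) :&: lker (ev f w2)))%VS.
    rewrite lker0_img_cap // F1 F2; apply/memv_capP.
    by rewrite !mem_lker_sandwich A1 A2.
  move=> /memv_imgP[M /memv_capP[M1 M2] ->]; apply: memv_img.
  move: M1 M2; rewrite !mem_lker_ev => /eqP M1 /eqP M2.
  by rewrite dep.
have [phiE3|phiE3] := eqVneq (phi *m E3) 0; last first.
  (* The matrices [m *m phi] with [L2 *m m = 0] show that [L3] vanishes on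
     the kernel of [L2], which makes the intersection of [R_2] and [R_3] too large. *)
  have L23 (m : 'cV_n) : L2 *m m = 0 -> L3 *m m = 0.
    move=> Lm; have [c Ec] := row_right_inverse phiE3.
    have := incl (m *m phi); rewrite -![_ *m (m *m phi) *m _]mulmxA.
    rewrite -!(mulmxA m) phiE1 !mulmx0 [L2 *m _]mulmxA Lm mul0mx.
    move=> /(_ erefl erefl)/(congr1 (fun x => x *m c)).
    by rewrite mul0mx -!mulmxA [phi *m _]mulmxA Ec mulmx1.
  have : (lker (sandwich L2 (1%:M : 'M_n)) <=
      lker (sandwich L2 E2) :&: lker (sandwich L3 E3))%VS.
    apply/subvP=> A; rewrite memv_cap !mem_lker_sandwich mulmx1 => /eqP LA.
    rewrite LA mul0mx eqxx /=; suff -> : L3 *m A = 0 by rewrite mul0mx.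
    apply/matrixP=> a b; rewrite [RHS]mxE.
    transitivity ((L3 *m col b A) a 0).
      by rewrite !mxE; apply: eq_bigr => l _; rewrite [col _ _ _ _]mxE.
    by rewrite L23 ?mxE // colE mulmxA LA mul0mx.
  move=> /dimvS; have := dim_lker_sandwich L2 (1%:M : 'M_n).
  rewrite rL2 mxrank1; lia.
(* Otherwise [E1] and [E3] have the same column space, so that the intersection of [R_1]
   and [R_3] has codimension [k * r], where [k] is the rank of [col_mx L1 L3]; but this
   codimension is [3 * r + 1]. *)
have E13 : (E1^T == E3^T)%MS.
  have sub (E : 'M_(n, r)) : \rank E = r -> phi *m E = 0 -> (E^T == kermx phi^T)%MS.
    move=> rE phiE; have s : (E^T <= kermx phi^T)%MS.
      by rewrite sub_kermx -trmx_mul phiE trmx0.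
    rewrite -(geq_leqif (mxrank_leqif_eq s)) mxrank_ker !mxrank_tr rE rank_rV phi0.
    by rewrite en addnK.
  have /eqmxP e1 := sub _ rE1 phiE1; have /eqmxP e3 := sub _ rE3 phiE3.
  by apply/eqmxP; apply: eqmx_trans e1 (eqmx_sym e3).
have [/submxP[Z e1] /submxP[Z' e3]] := andP E13.
have {}e1 : E1 = E3 *m Z^T by apply: trmx_inj; rewrite trmx_mul trmxK.
have {}e3 : E3 = E1 *m Z'^T by apply: trmx_inj; rewrite trmx_mul trmxK.
have cap13 : (lker (sandwich L1 E1) :&: lker (sandwich L3 E3))%VS =
    lker (sandwich (col_mx L1 L3) E1).
  apply/vspaceP=> A; rewrite memv_cap !mem_lker_sandwich !mul_col_mx.
  rewrite col_mx_eq0; congr (_ && _); apply/eqP/eqP => LA.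
    by rewrite e1 mulmxA LA mul0mx.
  by rewrite e3 mulmxA LA mul0mx.
have := dim_lker_sandwich (col_mx L1 L3) E1; rewrite -cap13 rE1.
move: (\rank _) => k dk; have : (k * r = 3 * r + 1)%N by lia.
have [k3|k4] := leqP k 3.
  have : (k * r <= 3 * r)%N by rewrite leq_mul2r k3 orbT.
  lia.
have : (4 * r <= k * r)%N by rewrite leq_mul2r k4 orbT.
lia.
Qed.

End Plane.

Section PlaneIntertwining.
Variables (K : fieldType) (X : vectType K) (n : nat).
Implicit Types (f i : 'Hom(X, 'M[K]_n)) (x z w g : 'cV[K]_n).

(** The matrices [i M] for which [f M] kills [w] have a common kernel vector. *)
Definition kernel_type i f w :=
  exists2 g : 'cV_n, g != 0 & forall M, f M *m w = 0 -> i M *m g = 0.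

(** On the plane of [x] and [z], the families [i] and [f] are intertwined by the linear map
    sending [x] to [g] and [z] to [g'], and by a nonzero matrix [B]. *)
Definition intertwined i f x z := exists (B : 'M_n) (g g' : 'cV_n),
  [/\ B != 0, forall M, i M *m g = B *m (f M *m x)
            & forall M, i M *m g' = B *m (f M *m z)].

Lemma mulmx_col_eq0 m (A : 'M[K]_(m, n)) : (forall x, A *m x = 0) -> A = 0.
Proof.
move=> A0; apply/matrixP=> a b; have := A0 (delta_mx b 0).
by rewrite -colE => /matrixP/(_ a 0); rewrite !mxE.
Qed.

Lemma kernel_type_scale i f w a : a != 0 ->
  kernel_type i f w -> kernel_type i f (a *: w).
Proof.
move=> a0 [g g0 gE]; exists g => // M; rewrite -scalemxAr => /eqP.
by rewrite scalemx_eq0 (negPf a0) => /eqP /gE.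
Qed.

Lemma intertwined_comb i f p q a b c d : intertwined i f p q ->
  intertwined i f (a *: p + b *: q) (c *: p + d *: q).
Proof.
move=> [B [g [g' [B0 e1 e2]]]].
exists B, (a *: g + b *: g'), (c *: g + d *: g'); split=> // M;
by rewrite !mulmxDr -!scalemxAr e1 e2.
Qed.

Variables (i f : 'Hom(X, 'M[K]_n)).
Hypothesis i_inj : injective i.
Hypothesis dimX : (n * n + 2 <= \dim {:X} + n)%N.

Lemma no_common_kernel g : g != 0 -> ~ (forall M, i M *m g = 0).
Proof.
move=> g0 ig; have := @common_kernel_dim _ _ _ i fullv _ g i_inj (fun M _ => ig M).
by rewrite -mxrank_tr rank_rV trmx_eq0 g0 muln1; lia.
Qed.

(** [i M *m g_k = B_k *m (f M *m w_k)] for the vectors [x], [z], [x + z].  The vectors [g_k]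
    are linearly dependent by a dimension count, and as the values of [f M] at [x] and
    [z] are arbitrary, a dependency forces the matrices [B_k] to be proportional. *)
Lemma intertwined3 x z : onto_at2 f x z ->
    kernel_type i f x -> kernel_type i f z -> kernel_type i f (x + z) ->
  intertwined i f x z.
Proof.
move=> gxz [g1 g10 k1] [g2 g20 k2] [g3 g30 k3].
have gs : onto_at2 f (x + z) z.
  have := @onto_at2_comb _ _ _ f x z 1 1 0 1 _ gxz.
  by rewrite !scale1r scale0r add0r; apply; rewrite mulr1 mulr0 subr0 oner_neq0.
have factor w g : (forall a, exists M, f M *m w = a) -> g != 0 ->
    (forall M, f M *m w = 0 -> i M *m g = 0) ->
    exists2 B, B != 0 & forall M, i M *m g = B *m (f M *m w).
  move=> onto g0 kg; have [|B BE] := lfun_factor_mx (limg_ev_onto onto) (b := ev i g).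
    by move=> M; rewrite !evE; apply: kg.
  have {}BE M : i M *m g = B *m (f M *m w) by rewrite -!evE.
  exists B => //; apply: contra_notN (no_common_kernel g0) => /eqP B0 M.
  by rewrite BE B0 mul0mx.
have [B1 B10 E1] := factor _ _ (onto_at2_left gxz) g10 k1.
have [B2 B20 E2] := factor _ _ (onto_at2_left (onto_at2_sym gxz)) g20 k2.
have [B3 B30 E3] := factor _ _ (onto_at2_left gs) g30 k3.
pose G := row_mx (row_mx g1 g2) g3.
have rG : (\rank G < 1 + 1 + 1)%N.
  rewrite ltn_neqAle rank_leq_col andbT; apply/eqP=> rG.
  have := @common_kernel_dim _ _ _ i (lker (ev f x) :&: lker (ev f z)) _ G i_inj.
  have := dim_lker_ev2 gxz; rewrite rG => d1 d2.
  have : (\dim (lker (ev f x) :&: lker (ev f z)) + n * 3 <= n * n)%N.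
    apply: d2 => M /memv_capP[]; rewrite !mem_lker_ev => /eqP Mx /eqP Mz.
    by rewrite !mul_mx_row k1 // k2 // k3 ?row_mx0 // mulmxDr Mx Mz addr0.
  lia.
have [c c0 Gc] : exists2 c : 'cV_(1 + 1 + 1), c != 0 & G *m c = 0.
  exists (nz_row (kermx G^T))^T.
    rewrite trmx_eq0 nz_row_eq0 -mxrank_eq0 mxrank_ker mxrank_tr.
    by rewrite -lt0n subn_gt0.
  apply: trmx_inj; rewrite trmx_mul trmxK trmx0; apply/eqP.
  by rewrite -sub_kermx nz_row_sub.
pose a := usubmx (usubmx c) 0 0; pose b := dsubmx (usubmx c) 0 0; pose d := dsubmx c 0 0.
have dep : a *: g1 + b *: g2 + d *: g3 = 0.
  rewrite -[RHS]Gc -[c in RHS]vsubmxK mul_row_col -[usubmx c in RHS]vsubmxK mul_row_col.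
  by rewrite [usubmx (usubmx c)]mx11_scalar [dsubmx (usubmx c)]mx11_scalar
    [dsubmx c]mx11_scalar !mul_mx_scalar.
have rel M : a *: (B1 *m (f M *m x)) + b *: (B2 *m (f M *m z))
    + d *: (B3 *m (f M *m x + f M *m z)) = 0.
  have := congr1 (mulmx (i M)) dep.
  by rewrite mulmx0 !mulmxDr -!scalemxAr E1 E2 E3 !mulmxDr.
have e1 : a *: B1 = - d *: B3.
  apply/eqP; rewrite scaleNr -subr_eq0 opprK; apply/eqP/mulmx_col_eq0 => p.
  have [M Mx Mz] := gxz p 0; have := rel M.
  by rewrite Mx Mz mulmx0 scaler0 !addr0 mulmxDl -!scalemxAl.
have e2 : b *: B2 = - d *: B3.
  apply/eqP; rewrite scaleNr -subr_eq0 opprK; apply/eqP/mulmx_col_eq0 => p.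
  have [M Mx Mz] := gxz 0 p; have := rel M.
  by rewrite Mx Mz mulmx0 scaler0 !add0r mulmxDl -!scalemxAl.
have d0 : d != 0.
  apply: contraNneq c0 => d0; move: e1 e2; rewrite d0 oppr0 scale0r.
  move=> /eqP; rewrite scalemx_eq0 (negPf B10) orbF => /eqP a0.
  move=> /eqP; rewrite scalemx_eq0 (negPf B20) orbF => /eqP b0.
  rewrite -[c]vsubmxK -[usubmx c]vsubmxK [usubmx (usubmx c)]mx11_scalar.
  rewrite [dsubmx (usubmx c)]mx11_scalar [dsubmx c]mx11_scalar.
  by rewrite -/a -/b -/d a0 b0 d0 raddf0 !col_mx0.
exists (- d *: B3), (a *: g1), (b *: g2); split=> [|M|M].
- by rewrite scalemx_eq0 oppr_eq0 negb_or d0.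
- by rewrite -scalemxAr E1 -e1 scalemxAl.
- by rewrite -scalemxAr E2 -e2 scalemxAl.
Qed.

Lemma intertwined_plane x z : onto_at2 f x z ->
  unbounded (fun t => kernel_type i f (x + t *: z)) -> intertwined i f x z.
Proof.
move=> gxz /unbounded3[t1 [t2 [t3 [[k1 k2 k3] [t12 t13 t23]]]]].
pose w t := x + t *: z; pose D := t1 - t2.
have D0 : D != 0 by rewrite subr_eq0.
(* The coefficients of [w t3] on [w t1] and [w t2]. *)
pose a := (t3 - t2) / D; pose b := (t1 - t3) / D.
have a0 : a != 0 by rewrite mulf_neq0 ?invr_neq0 // subr_eq0 eq_sym.
have b0 : b != 0 by rewrite mulf_neq0 ?invr_neq0 // subr_eq0.
have e3 : a *: w t1 + b *: w t2 = w t3.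
  by apply/matrixP=> j k; rewrite !mxE /a /b /D; field.
have g12 : onto_at2 f (a *: w t1) (b *: w t2).
  have -> : a *: w t1 = a *: x + (a * t1) *: z by rewrite scalerDr scalerA.
  have -> : b *: w t2 = b *: x + (b * t2) *: z by rewrite scalerDr scalerA.
  apply: onto_at2_comb gxz.
  have -> : a * (b * t2) - a * t1 * b = - (a * b * D) by rewrite /D; ring.
  by rewrite oppr_eq0 (mulf_neq0 (mulf_neq0 a0 b0) D0).
have I12 : intertwined i f (a *: w t1) (b *: w t2).
  apply: intertwined3 => //; try exact: kernel_type_scale.
  by rewrite e3.
have -> : x = (- t2 / D / a) *: (a *: w t1) + (t1 / D / b) *: (b *: w t2).
  by apply/matrixP=> j k; rewrite !mxE /D; field; rewrite D0 a0 b0.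
have -> : z = (D^-1 / a) *: (a *: w t1) + (- D^-1 / b) *: (b *: w t2).
  by apply/matrixP=> j k; rewrite !mxE /D; field; rewrite D0 a0 b0.
exact: intertwined_comb.
Qed.

(** Otherwise the matrices [i M] with [f M *m x = 0] would have both a common kernel vector
    and a common left kernel vector. *)
Lemma intertwined_tr_excl x z z' : onto_at2 f x z ->
  intertwined i f x z -> ~ intertwined (linfun trmx \o i)%VF f x z'.
Proof.
move=> gxz [B [g [_ [B0 gE _]]]] [C [h [_ [C0 hE _]]]].
have nz (i' : 'Hom(X, 'M[K]_n)) A y : A != 0 ->
    (forall M, i' M *m y = A *m (f M *m x)) -> y != 0.
  move=> A0 yE; apply: contraNneq A0 => y0; apply/eqP/mulmx_col_eq0 => p.
  by have [M Mx _] := gxz p 0; rewrite -Mx -yE y0 mulmx0.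
have g0 := nz _ _ _ B0 gE; have h0 := nz _ _ _ C0 hE.
have hT0 : h^T != 0 by rewrite trmx_eq0.
have := @isotropic_dim _ _ _ _ (i @: lker (ev f x)) fullv hT0 g0.
rewrite dim_limg_inj // => iso.
have {iso} : (\dim (lker (ev f x)) + \dim {:('rV[K]_n * 'cV[K]_n)%type} <= n * n + 1)%N.
  apply: iso => q _ _ /memv_imgP[M kM ->].
  move: kM; rewrite mem_lker_ev => /eqP Mx.
  rewrite -mulmxA gE Mx mulmx0 mulmx0 add0r.
  have := hE M; rewrite comp_lfunE lfunE /= Mx mulmx0 => /(congr1 trmx).
  by rewrite trmx_mul trmxK trmx0 => ->; rewrite mul0mx.
have := dim_lker_ev (onto_at2_left gxz).
have -> : \dim {:('rV[K]_n * 'cV[K]_n)%type} = (n + n)%N.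
  by rewrite dimvf; transitivity (1 * n + n * 1)%N; last rewrite mul1n muln1.
lia.
Qed.

End PlaneIntertwining.

(** * Evaluation of a large space of matrices at one or two vectors *)

Section OntoEvaluation.
Variable K : fieldType.

Lemma basis_or_hyperplane m (A : 'rV[K]_m -> Prop) :
  (exists2 Z : 'M_m, Z \in unitmx & forall j, A (row j Z)) \/
  (exists2 phi : 'cV_m, phi != 0 & forall b, A b -> b *m phi = 0).
Proof.
suff step k : (k <= m)%N ->
    (exists2 Z : 'M_(k, m), \rank Z = k & forall j, A (row j Z)) \/
    (exists2 phi : 'cV_m, phi != 0 & forall b, A b -> b *m phi = 0).
  have [[Z rZ AZ]|] := step m (leqnn m); last by right.
  by left; exists Z => //; rewrite -row_free_unit; apply/eqP.
elim: k => [|k IHk] km.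
  by left; exists 0 => [|[]//]; rewrite mxrank0.
have [[Z rZ AZ]|] := IHk (ltnW km); last by right.
have [sub|] := pselect (forall b, A b -> (b <= Z)%MS).
  right; exists (nz_row (kermx Z^T))^T.
    by rewrite trmx_eq0 nz_row_eq0 -mxrank_eq0 mxrank_ker mxrank_tr rZ -lt0n subn_gt0.
  move=> b /sub/submxP[c ->]; rewrite -mulmxA.
  rewrite (_ : Z *m _ = 0) ?mulmx0 //; apply: trmx_inj.
  rewrite trmx_mul trmxK trmx0; apply/eqP.
  by rewrite -sub_kermx nz_row_sub.
move=> /existsNP[b /not_implyP[Ab /negP nb]]; left.
suff [Z' rZ' AZ'] : exists2 Z' : 'M_(k + 1, m),
    \rank Z' = (k + 1)%N & forall j, A (row j Z').
  by move: Z' rZ' AZ'; rewrite addn1 => Z' rZ' AZ'; exists Z'.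
exists (col_mx Z b).
  apply/eqP; rewrite eqn_leq rank_leq_row /= -addsmxE [X in (X <= _)%N]addn1.
  have : (Z < Z + b)%MS by rewrite ltmxE addsmxSl addsmx_sub submx_refl.
  by move/rank_ltmx; rewrite rZ.
move=> j; case: (split_ordP j) => l ->; first by rewrite rowKu.
by rewrite rowKd; have -> : row l b = b by apply/rowP=> c; rewrite !mxE ord1.
Qed.

(** If the values of [h] at [z] do not fill the space, then [y *m h M *m z = 0] for some
    [y != 0] and all [M].  Such vectors [z] lie in a hyperplane: if some of them, say
    [z_j], formed a basis, the matrices [z_j *m y_j] would be [m] linearly independent
    matrices orthogonal to the image of [h], whose codimension is less than [m]. *)
Lemma onto_off_hyperplane (Y : vectType K) n m (h : 'Hom(Y, 'M[K]_(n, m))) :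
    injective h -> (n * m < \dim {:Y} + m)%N ->
  exists2 phi : 'rV_m, phi != 0 &
    forall z : 'cV_m, phi *m z != 0 -> forall a, exists M, h M *m z = a.
Proof.
move=> h_inj dimY.
pose A (b : 'rV[K]_m) := exists2 y : 'rV_n, y != 0 & forall M, y *m h M *m b^T = 0.
have onto (z : 'cV_m) : ~ A z^T -> forall a, exists M, h M *m z = a.
  move=> nA a; pose e := (sandwich 1%:M z \o h)%VF.
  have eE M : e M = h M *m z by rewrite comp_lfunE sandwichE mul1mx.
  have : a \in limg e.
    apply: contrapT => /negP/separate_vspace[c cW ca]; apply: nA; exists c.
      apply: contra_eq_neq ca => ->; rewrite mul0mx eq_sym.
      by apply/eqP=> /matrixP/(_ 0 0)/eqP; rewrite !mxE oner_eq0.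
    by move=> M; rewrite trmxK -mulmxA -eE cW // memv_img ?memvf.
  by move=> /memv_imgP[M _ ->]; exists M.
have [[Z Zu AZ]|[phi phi0 Aphi]] := basis_or_hyperplane A; last first.
  exists phi^T; first by rewrite trmx_eq0.
  move=> z pz; apply: onto => /Aphi/(congr1 trmx).
  by rewrite trmx_mul trmxK trmx0; apply/eqP.
have [y y0 yZ] := fin_all_exists2 AZ.
pose Y' := \matrix_j y j.
pose dg : 'Hom('rV[K]_m, 'M[K]_m) := linfun (@diag_mx K m).
pose e := (sandwich Z^T Y' \o dg)%VF.
have eE d : e d = Z^T *m diag_mx d *m Y' by rewrite comp_lfunE sandwichE lfunE.
have e_inj : injective e.
  apply/lker0P; rewrite -subv0; apply/subvP=> d; rewrite memv_ker memv0 eE.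
  move=> /eqP/(congr1 (mulmx (invmx Z^T))).
  rewrite !mulmxA mulVmx ?unitmx_tr // mul1mx mulmx0 => dY.
  apply/eqP/rowP=> j; rewrite [RHS]mxE; apply: contraNeq (y0 j) => dj.
  have := congr1 (row j) dY; rewrite mul_diag_mx row0 => /rowP djy.
  apply/eqP/rowP=> l; have := djy l; rewrite !mxE => /eqP.
  by rewrite mulf_eq0 (negPf dj) => /eqP.
have := @trace_orthogonal_dim _ _ _ (h @: fullv) (limg e).
rewrite !dim_limg_inj // (dim_mx K) mul1n => orth.
have : (\dim {:Y} + m <= n * m)%N.
  apply: orth => _ _ /memv_imgP[M _ ->] /memv_imgP[d _ ->]; rewrite eE.
  rewrite !mulmxA mxtrace_mulC !mulmxA mul_mx_diag /mxtrace big1 // => j _.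
  rewrite mxE; have /matrixP/(_ 0 0) := yZ j M; rewrite [RHS]mxE => e0.
  rewrite [X in X * _](_ : _ = 0) ?mul0r // -[RHS]e0 !mxE.
  apply: eq_bigr => l _; rewrite !mxE; congr (_ * _).
  by apply: eq_bigr => l' _; rewrite !mxE.
by rewrite leqNgt dimY.
Qed.

(** [C] parametrizes the kernel of [al], and [D] gives the coordinates of the projection
    onto this kernel along [x]. *)
Lemma hyperplane_retract n (x : 'cV[K]_n) (al : 'rV[K]_n) : al *m x = 1%:M ->
  exists d (C : 'M_(n, d)) (D : 'M_(d, n)),
    [/\ (d + 1)%N = n, C *m D = 1%:M - x *m al & D *m C = 1%:M].
Proof.
move=> alx; pose p := 1%:M - x *m al.
have px : p *m x = 0 by rewrite mulmxBl mul1mx -mulmxA alx mulmx1 subrr.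
have pp : p *m p = p by rewrite {2}/p mulmxBr mulmx1 mulmxA px mul0mx subr0.
have x1 : \rank x = 1%N.
  have := mxrankM_maxr al x; rewrite alx mxrank1 => ?.
  by apply/eqP; rewrite eqn_leq rank_leq_col.
have rp : (\rank p + 1)%N = n.
  apply/eqP; rewrite eqn_leq -{1}x1 mulmx0_rank_max //=.
  rewrite -[X in (X <= _)%N](mxrank1 K) -(subrK (x *m al) 1%:M).
  apply: leq_trans (mxrank_add _ _) _; rewrite leq_add2l.
  by apply: leq_trans (mxrankM_maxl _ _) _; rewrite x1.
have [d [C [D [C' [D' [ed eCD C'C DD']]]]]] := rank_factorization p.
exists d, C, D; split; first by rewrite ed.
  by rewrite -eCD.
move: pp; rewrite eCD => /(congr1 (fun A => C' *m A *m D')).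
by rewrite !mulmxA C'C !mul1mx -!mulmxA DD' !mulmx1.
Qed.

(** [onto_off_hyperplane] is applied first to [f], which yields [x], and then to the
    restriction of the matrices [f M] with [f M *m x = 0] to a complement of [x]. *)
Lemma onto_at_off_hyperplane (X : vectType K) n (f : 'Hom(X, 'M[K]_n)) :
    injective f -> (1 < n)%N -> (n * n + 2 <= \dim {:X} + n)%N ->
  exists x (phi : 'rV_n), phi != 0 /\ forall z, phi *m z != 0 -> onto_at2 f x z.
Proof.
move=> f_inj n1 dimX.
have [|al al0 onto] := onto_off_hyperplane f_inj; first by lia.
have [x alx] := row_right_inverse al0.
have {}onto a : exists M, f M *m x = a.
  by apply: onto; rewrite alx; apply/eqP=> /matrixP/(_ 0 0)/eqP; rewrite !mxE oner_eq0.
have [d [C [D [en CD DC]]]] := hyperplane_retract alx.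
pose Y := subvs_of (lker (ev f x)).
pose h := ((sandwich 1%:M C \o f) \o linfun (vsval : Y -> X))%VF.
have hE (M : Y) : h M = f (vsval M) *m C.
  by rewrite !comp_lfunE sandwichE mul1mx lfunE.
have Yx (M : Y) : f (vsval M) *m x = 0.
  by apply/eqP; rewrite -mem_lker_ev subvsP.
have h_inj : injective h.
  apply/lker0P; rewrite -subv0; apply/subvP=> M; rewrite memv_ker memv0 hE => /eqP MC.
  apply/eqP/subvs_inj/f_inj; rewrite !linear0.
  rewrite -[LHS]mulmx1 -(subrK (x *m al) 1%:M) -CD mulmxDr !mulmxA MC Yx.
  by rewrite !mul0mx addr0.
have dimY : \dim {:Y} = \dim (lker (ev f x)) by rewrite dimvf.
have [|phi phi0 ontoY] := onto_off_hyperplane h_inj.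
  rewrite dimY; have := dim_lker_ev onto; move: dimX; nia.
exists x, (phi *m D); split.
  apply: contraNneq phi0 => pD.
  by rewrite -[phi]mulmx1 -DC mulmxA pD mul0mx.
move=> z; rewrite -mulmxA => pz a b.
have [M1 M1x] := onto a; have [M2 M2z] := ontoY _ pz (b - f M1 *m z).
exists (M1 + vsval M2); rewrite linearD mulmxDl; first by rewrite M1x Yx addr0.
rewrite -[z in f (vsval M2) *m z]mul1mx -(subrK (x *m al) 1%:M) -CD.
rewrite mulmxDl mulmxDr !mulmxA Yx !mul0mx addr0 -hE -[h M2 *m D *m z]mulmxA M2z.
by rewrite addrC subrK.
Qed.

End OntoEvaluation.

(** * Reconstruction of the Frobenius automorphism *)

Section Reconstruction.
Variables (K : fieldType) (X : vectType K).

(** If [b < n] and [g < n], then [(n - b) * g >= (n - b) + g - 1] and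
    [b * (n - g) >= b + (n - g) - 1], and one of these bounds is at least [n - 1]. *)
Lemma product_gap n b g : (0 < b <= n)%N -> (0 < g <= n)%N ->
    (b * (n - g) + 2 <= n)%N -> ((n - b) * g + 2 <= n)%N -> b = n /\ g = n.
Proof.
move=> /andP[b0 bn] /andP[g0 gn].
have [p ep] : exists p, n = (b + p)%N by exists (n - b)%N; rewrite subnKC.
have [q eq] : exists q, n = (g + q)%N by exists (n - g)%N; rewrite subnKC.
rewrite {1 3}ep {1 3}eq !addKn => h1 h2.
have [p0|p0] := posnP p; have [q0|q0] := posnP q; try lia; nia.
Qed.

(** As the common kernel vector at [x] is unique up to a scalar, the matrices [B] of the
    various planes through [x] can be made equal, and then the intertwining relation is
    linear in [z]. *)
Lemma intertwining_equivalence n (i f : 'Hom(X, 'M[K]_n)) x z1 (phi : 'rV_n) :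
    injective i -> injective f -> (n * n + 2 <= \dim {:X} + n)%N ->
    phi *m z1 = 1%:M -> onto_at2 f x z1 ->
    (forall z, phi *m z != 0 -> intertwined i f x z) ->
  exists P Q, [/\ P \in unitmx, Q \in unitmx & forall M, f M = P *m i M *m Q].
Proof.
move=> i_inj f_inj dimX pz1 gx1 inter.
have one0 : (1%:M : 'M[K]_1) != 0.
  by apply/eqP=> /matrixP/(_ 0 0)/eqP; rewrite !mxE oner_eq0.
have onto := onto_at2_left gx1.
have [B [g0 [_ [B0 g0E _]]]] : intertwined i f x z1 by apply: inter; rewrite pz1.
have mx_inj (A A' : 'M[K]_n) :
    (forall M, A *m (f M *m x) = A' *m (f M *m x)) -> A = A'.
  move=> AA'; apply/eqP; rewrite -subr_eq0; apply/eqP/mulmx_col_eq0 => p.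
  by have [M <-] := onto p; rewrite mulmxBl AA' subrr.
have g00 : g0 != 0.
  apply: contraNneq B0 => e; apply/eqP/mx_inj => M.
  by rewrite -g0E e mulmx0 mul0mx.
pose R (z : 'cV_n) := exists h : 'cV_n, forall M, i M *m h = B *m (f M *m z).
have Roff z : phi *m z != 0 -> R z.
  move=> /inter[B' [g [g' [B'0 gE g'E]]]].
  have /submxP[k ek] : (g^T <= g0^T)%MS.
    apply: contrapT => /negP ng.
    have := @common_kernel_dim _ _ _ i (lker (ev f x)) _ (row_mx g0 g) i_inj.
    have -> : \rank (row_mx g0 g) = 2.
      apply/eqP; rewrite eqn_leq rank_leq_col -mxrank_tr tr_row_mx -addsmxE.
      have : (g0^T < g0^T + g^T)%MS by rewrite ltmxE addsmxSl addsmx_sub submx_refl.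
      by move/rank_ltmx; rewrite {1}rank_rV trmx_eq0 g00.
    have := dim_lker_ev onto => dk ck.
    have : (\dim (lker (ev f x)) + n * 2 <= n * n)%N.
      apply: ck => M; rewrite mem_lker_ev => /eqP Mx.
      by rewrite mul_mx_row g0E gE Mx !mulmx0 row_mx0.
    lia.
  have {}ek : g = k 0 0 *: g0.
    by apply: trmx_inj; rewrite ek {1}[k]mx11_scalar mul_scalar_mx linearZ.
  have eB : B' = k 0 0 *: B.
    by apply: mx_inj => M; rewrite -gE ek -scalemxAr g0E scalemxAl.
  have k0 : k 0 0 != 0 by apply: contraNneq B'0 => k0; rewrite eB k0 scale0r.
  exists ((k 0 0)^-1 *: g') => M.
  by rewrite -scalemxAr g'E eB -scalemxAl scalerA mulVf // scale1r.
have Rall z : R z.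
  have [pz|] := eqVneq (phi *m z) 0; last exact: Roff.
  have [|h hE] := Roff (z + z1); first by rewrite mulmxDr pz add0r pz1.
  have [|h1 h1E] := Roff z1; first by rewrite pz1.
  by exists (h - h1) => M; rewrite mulmxBr hE h1E -mulmxBr -mulmxBr addrK.
have [h hE] := fin_all_exists (fun j : 'I_n => Rall (delta_mx j 0)).
(* [B] and [G] are invertible: [kermx B *m i M *m G = 0] and [B *m f M *m cokermx G = 0]
   for all [M], so that both products of ranks are bounded by the codimension. *)
pose G := \matrix_(a, b) h b a 0.
have GE M : i M *m G = B *m f M.
  apply/matrixP=> a b; have /matrixP/(_ a 0) := hE b M.
  rewrite mulmxA -colE [col _ _ _ _]mxE => <-.
  by rewrite !mxE; apply: eq_bigr => l _; rewrite mxE.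
have G0 : G != 0.
  apply: contraNneq B0 => e; apply/eqP/mx_inj => M.
  by rewrite !mulmxA -GE e mulmx0 !mul0mx.
have h1 : (\dim {:X} + \rank B * (n - \rank G) <= n * n)%N.
  rewrite -[(n - _)%N]mxrank_coker -(dim_lker_sandwich B (cokermx G)) leq_add2r.
  rewrite -(dim_limg_inj _ f_inj) dimvS //; apply/subvP=> _ /memv_imgP[M _ ->].
  by rewrite mem_lker_sandwich -GE -mulmxA mulmx_coker mulmx0.
have h2 : (\dim {:X} + (n - \rank B) * \rank G <= n * n)%N.
  rewrite -[(n - _)%N]mxrank_ker -(dim_lker_sandwich (kermx B) G) leq_add2r.
  rewrite -(dim_limg_inj _ i_inj) dimvS //; apply/subvP=> _ /memv_imgP[M _ ->].
  by rewrite mem_lker_sandwich -mulmxA GE mulmxA mulmx_ker mul0mx.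
have [|||| rB rG] := @product_gap n (\rank B) (\rank G).
- by rewrite lt0n mxrank_eq0 B0 rank_leq_row.
- by rewrite lt0n mxrank_eq0 G0 rank_leq_row.
- by lia.
- by lia.
have Bu : B \in unitmx by rewrite -row_free_unit /row_free rB.
have Gu : G \in unitmx by rewrite -row_free_unit /row_free rG.
exists (invmx B), G; split; rewrite ?unitmx_inv // => M.
by rewrite -mulmxA GE mulKmx.
Qed.

End Reconstruction.

Section Preserver.
Variables (K : fieldType) (X : vectType K) (r : nat).
Let n := (r + 1)%N.
Variables (i f : 'Hom(X, 'M[K]_n)).
Hypothesis Kinf : @unbounded K (fun=> True).
Hypothesis i_inj : injective i.
Hypothesis f_inj : injective f.
Hypothesis dimX : (n * n + 2 <= \dim {:X} + n)%N.
Hypothesis f_unit : forall M, i M \in unitmx -> f M \in unitmx.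

Let it := (linfun trmx \o i)%VF.

Let it_inj : injective it.
Proof. by move=> A B; rewrite !comp_lfunE => /trmx_lfun_inj/i_inj. Qed.

Let it_img W a b : compressed (i @: W) a b -> compressed (it @: W) b a.
Proof. by rewrite limg_comp; apply: compressed_tr. Qed.

Let kernel_type_of (j : 'Hom(X, 'M[K]_n)) w :
  compressed (j @: lker (ev f w)) n 1 -> kernel_type j f w.
Proof.
move=> [L [E [rL rE LE]]]; have Lu : L \in unitmx.
  by rewrite -row_free_unit; apply/eqP.
exists E; first by rewrite -mxrank_eq0 rE.
move=> M Mw; have := LE (j M); rewrite memv_img ?mem_lker_ev ?Mw // => /(_ isT).
by move/(congr1 (mulmx (invmx L))); rewrite mulmx0 -mulmxA mulKmx.
Qed.

(** One of the four cases of [singular_space_compressed] occurs infinitely often on the line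
    [x + t *: z].  Transposition exchanges the first two cases, and the last two, which
    [no_three_compressed2] excludes. *)
Lemma intertwined_or_tr x z : onto_at2 f x z ->
  intertwined i f x z \/ intertwined it f x z.
Proof.
move=> gxz.
have gt t t' : t != t' -> onto_at2 f (x + t *: z) (x + t' *: z).
  move=> tt'; have := @onto_at2_comb _ _ _ f x z 1 t 1 t' _ gxz.
  by rewrite scale1r; apply; rewrite mul1r mulr1 subr_eq0 eq_sym.
have gz t : onto_at2 f (x + t *: z) z.
  have := @onto_at2_comb _ _ _ f x z 1 t 0 1 _ gxz.
  by rewrite !scale1r scale0r add0r; apply; rewrite mulr1 mulr0 subr0 oner_neq0.
pose comp2 (j : 'Hom(X, 'M[K]_n)) t :=
  (1 < r)%N /\ compressed (j @: lker (ev f (x + t *: z)))%VS 2 r.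
have types t : (kernel_type i f (x + t *: z) \/ kernel_type it f (x + t *: z)) \/
    (comp2 i t \/ comp2 it t).
  rewrite /comp2; set w := x + t *: z.
  have onto a : exists M, f M *m w = a by apply: onto_at2_left (gz t) a.
  have w0 : w != 0.
    apply/eqP=> w0; have [M /matrixP/(_ (rshift r 0) 0)/eqP] := onto (const_mx 1).
    by rewrite w0 mulmx0 !mxE eq_sym oner_eq0.
  have dk := dim_lker_ev onto.
  have sing : {in (i @: lker (ev f w))%VS, forall A, \det A = 0}.
    move=> _ /memv_imgP[M Mw ->]; apply/eqP; apply: contraNT w0.
    rewrite -unitfE -unitmxE => /f_unit fu; move: Mw; rewrite mem_lker_ev => /eqP.
    by move=> /(congr1 (mulmx (invmx (f M)))); rewrite mulKmx // mulmx0 => ->.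
  have [] := singular_space_compressed Kinf sing.
  - by rewrite dim_limg_inj //; move: dk dimX; rewrite /n; nia.
  - by move=> /it_img/kernel_type_of ?; left; right.
  - by move=> /kernel_type_of ?; left; left.
  - by move=> ?; right; left.
  by move=> [r1 /it_img ?]; right; right.
have no_comp2 (j : 'Hom(X, 'M[K]_n)) : injective j -> ~ unbounded (comp2 j).
  move=> j_inj /unbounded3[t1 [t2 [t3 [[[r1 c1] [_ c2] [_ c3]] [t12 t13 t23]]]]].
  apply: (no_three_compressed2 j_inj dimX r1 _ _ _ c1 c2 c3); try exact: gt.
  move=> M M1 M2; have D0 : t1 - t2 != 0 by rewrite subr_eq0.
  have -> : x + t3 *: z = ((t3 - t2) / (t1 - t2)) *: (x + t1 *: z) +
      ((t1 - t3) / (t1 - t2)) *: (x + t2 *: z).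
    by apply/matrixP=> a b; rewrite !mxE; field.
  by rewrite mulmxDr -!scalemxAr M1 M2 !scaler0 addr0.
have : unbounded (fun t =>
    (kernel_type i f (x + t *: z) \/ kernel_type it f (x + t *: z)) \/
    (comp2 i t \/ comp2 it t)).
  by move=> s; have [t ts _] := Kinf s; exists t.
move=> /unbounded_or[/unbounded_or[]|/unbounded_or[]].
- by left; apply: intertwined_plane.
- by right; apply: intertwined_plane.
- by move=> /(no_comp2 i).
by move=> /(no_comp2 it).
Qed.

Lemma preserver_is_frobenius :
  exists P Q, [/\ P \in unitmx, Q \in unitmx &
    (forall M, f M = P *m i M *m Q) \/ (forall M, f M = P *m (i M)^T *m Q)].
Proof.
have n1 : (1 < n)%N.
  have : (\dim {:X} <= n * n)%N.
    by rewrite -(dim_limg_inj _ i_inj) -(dim_mx K) dimvS // subvf.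
  by move: dimX; rewrite /n; lia.
have [x [phi [phi0 gphi]]] := onto_at_off_hyperplane f_inj n1 dimX.
have [z1 pz1] := row_right_inverse phi0.
have gx1 : onto_at2 f x z1.
  by apply: gphi; rewrite pz1; apply/eqP=> /matrixP/(_ 0 0)/eqP; rewrite !mxE oner_eq0.
have [I1|I1] := intertwined_or_tr gx1.
  have [|P [Q [Pu Qu E]]] := intertwining_equivalence i_inj f_inj dimX pz1 gx1.
    move=> z /gphi/intertwined_or_tr[] // It.
    by case: (intertwined_tr_excl i_inj dimX gx1 I1 It).
  by exists P, Q; split=> //; left.
have [|P [Q [Pu Qu E]]] := intertwining_equivalence it_inj f_inj dimX pz1 gx1.
  move=> z /gphi gz; have [It|//] := intertwined_or_tr gz.
  by case: (intertwined_tr_excl i_inj dimX gz It I1).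
exists P, Q; split=> //; right=> M.
by rewrite E comp_lfunE lfunE.
Qed.

End Preserver.

Theorem theorem3 (K : fieldType) (K_infinite : infinite_set [set: K]%classic)
    (n : nat) (n_gt0 : (0 < n)%N)
    (V : {vspace 'M[K]_n}) (codimV : (codim V < n - 1)%N)
    (f : {linear subvs_of V -> 'M[K]_n}) (f_inj : injective f)
    (f_GL : forall M : subvs_of V, vsval M \in unitmx -> f M \in unitmx) :
  exists2 phi : 'M[K]_n -> 'M[K]_n, frobenius_automorphism phi &
    forall M : subvs_of V, phi (vsval M) = f M.
Proof.
have [r en] : exists r, n = (r + 1)%N by exists n.-1; rewrite addn1 prednK.
subst n.
have dimX : ((r + 1) * (r + 1) + 2 <= \dim {:subvs_of V} + (r + 1))%N.
  have -> : \dim {:subvs_of V} = \dim V by rewrite dimvf.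
  by move: codimV; rewrite /codim (dim_mx K); nia.
have v_inj : injective (linfun (vsval : subvs_of V -> 'M[K]_(r + 1))).
  by move=> A B; rewrite !lfunE => /subvs_inj.
have g_inj : injective (linfun f) by move=> A B; rewrite !lfunE => /f_inj.
have [|P [Q [Pu Qu fE]]] :=
    preserver_is_frobenius (unboundedT K_infinite) v_inj g_inj dimX.
  by move=> M; rewrite !lfunE; apply: f_GL.
case: fE => fE.
  exists (fun M => P *m M *m Q); first by exists P, Q; split=> //; left.
  by move=> M; have := fE M; rewrite !lfunE.
exists (fun M => P *m M^T *m Q); first by exists P, Q; split=> //; right.
by move=> M; have := fE M; rewrite !lfunE.
Qed.
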